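(* Suppose $\Gamma$ is a finitely generated $2$-relator group acting by isometries on hyperbolic space $\mathbb H^n$ with infimum displacement $\geq 2000$. Then $\Gamma$ has cohomological dimension $\leq 2$.
   Context: A finitely generated $2$-relator group is a group having a presentation with finitely many generators and two relators. The infimum displacement of an isometric action of $\Gamma$ on $\mathbb H^n$ is $\inf\{d(p,\gamma p): p\in\mathbb H^n,\ \gamma\in\Gamma\setminus\{1\}\}$. Cohomological dimension is over $\mathbb Z$, i.e. the minimal length of a projective resolution of the trivial module $\mathbb Z$ over $\mathbb Z\Gamma$. *)

(* Defs.v *)
From HB Require Import structures.
From mathcomp Require Import all_boot all_order all_algebra finmap.
From mathcomp Require Import boolp classical_sets reals constructive_ereal ereal exp.

Set Implicit Arguments.
Unset Strict Implicit.
Unset Printing Implicit Defensive.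

Import Order.TTheory GRing.Theory Num.Theory.

Section FreeGroup.
Variable X : choiceType.

(* (x, false) stands for x and (x, true) for x^-1. *)
Definition letter : Type := (X * bool)%type.
HB.instance Definition _ := Choice.on letter.

Definition flip (a : letter) : letter := (a.1, ~~ a.2).

Definition reduced (w : seq letter) : bool := sorted (fun a b => b != flip a) w.

Definition cons_red (a : letter) (w : seq letter) : seq letter :=
  if w is b :: w' then if b == flip a then w' else a :: w else [:: a].

Definition reduce (w : seq letter) : seq letter := foldr cons_red [::] w.

Lemma flipK : involutive flip.
Proof. by case=> x b; rewrite /flip /= negbK. Qed.

Lemma reduced_behead a w : reduced (a :: w) -> reduced w.
Proof. exact: path_sorted. Qed.

Lemma reduced_cons_red a w : reduced w -> reduced (cons_red a w).
Proof.
case: w => [//|b w] rw /=; case: eqP => [_|/eqP nb]; first exact: reduced_behead rw.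
by rewrite /reduced /= nb.
Qed.

Lemma reduced_reduce w : reduced (reduce w).
Proof. by elim: w => //= a w; exact: reduced_cons_red. Qed.

Lemma cons_red_id a w : reduced (a :: w) -> cons_red a w = a :: w.
Proof. by case: w => [//|b w] /= /andP[/negPf-> _]. Qed.

Lemma cons_redK a w : reduced w -> cons_red (flip a) (cons_red a w) = w.
Proof.
case: w => [|b w] rw /=; first by rewrite flipK eqxx.
have [eb|nb] := eqVneq b (flip a); last by rewrite /= flipK eqxx.
by rewrite -eb cons_red_id.
Qed.

Lemma reduce_id w : reduced w -> reduce w = w.
Proof.
elim: w => //= a w IHw rw; rewrite IHw ?cons_red_id //.
exact: reduced_behead rw.
Qed.

Lemma foldr_cons_red a u w : reduced w ->
  foldr cons_red w (cons_red a u) = cons_red a (foldr cons_red w u).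
Proof.
move=> rw; case: u => [//|b u] /=; have [->|//] := eqVneq b (flip a).
have ru : reduced (foldr cons_red w u).
  by elim: u => //= c u; exact: reduced_cons_red.
by have := cons_redK (flip a) ru; rewrite flipK => ->.
Qed.

Lemma reduce_catl u v : reduce (reduce u ++ v) = reduce (u ++ v).
Proof.
rewrite /reduce !foldr_cat -!/(reduce v).
elim: u => //= a u IHu; rewrite foldr_cons_red ?reduced_reduce //.
by rewrite IHu.
Qed.

Lemma reduce_catr u v : reduce (u ++ reduce v) = reduce (u ++ v).
Proof. by rewrite /reduce !foldr_cat -!/(reduce _) reduce_id ?reduced_reduce. Qed.

Definition word_inv (w : seq letter) : seq letter := rev (map flip w).

Lemma word_invK : involutive word_inv.
Proof. by move=> w; rewrite /word_inv map_rev revK -map_comp map_id_in // => a _; exact: flipK. Qed.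

Lemma reduce_word_invl w : reduce (word_inv w ++ w) = [::].
Proof.
elim: w => //= a w IHw; rewrite /word_inv /= rev_cons -/(word_inv w) cat_rcons.
rewrite /reduce foldr_cat /= cons_redK ?reduced_reduce //.
by rewrite -foldr_cat.
Qed.

Lemma reduced_word_inv w : reduced w -> reduced (word_inv w).
Proof.
rewrite /reduced /word_inv rev_sorted sorted_map.
by apply: sub_sorted => a b /=; rewrite flipK; apply: contra => /eqP ->.
Qed.

Record free_group := FreeGroup { fg_val :> seq letter; _ : reduced fg_val }.
HB.instance Definition _ := [isSub for fg_val].
HB.instance Definition _ := [Choice of free_group by <:].

Definition fg_of (w : seq letter) : free_group := FreeGroup (reduced_reduce w).

Definition fg_mul (u v : free_group) : free_group := fg_of (u ++ v).
Definition fg_one : free_group := @FreeGroup [::] isT.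
Definition fg_inv (u : free_group) : free_group :=
  FreeGroup (reduced_word_inv (valP u)).

Lemma fg_mulA : associative fg_mul.
Proof.
by move=> u v w; apply: val_inj; rewrite /= reduce_catl reduce_catr catA.
Qed.

Lemma fg_mul1g : left_id fg_one fg_mul.
Proof. by move=> u; apply: val_inj; rewrite /= reduce_id //; exact: valP. Qed.

Lemma fg_mulg1 : right_id fg_one fg_mul.
Proof. by move=> u; apply: val_inj; rewrite /= cats0 reduce_id //; exact: valP. Qed.

Lemma fg_mulVg : left_inverse fg_one fg_inv fg_mul.
Proof. by move=> u; apply: val_inj; exact: reduce_word_invl. Qed.

Lemma fg_mulgV : right_inverse fg_one fg_inv fg_mul.
Proof.
by move=> u; apply: val_inj; rewrite /= -{1}[fg_val u]word_invK reduce_word_invl.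
Qed.

HB.instance Definition _ := isGroup.Build free_group
  fg_mulA fg_mul1g fg_mulg1 fg_mulVg fg_mulgV.

End FreeGroup.

Section Presentations.
Local Open Scope group_scope.
Local Open Scope classical_set_scope.

Definition normal_subgroup (G : groupType) (N : set G) : Prop :=
  [/\ N 1, (forall x y, N x -> N y -> N (x * y)), (forall x, N x -> N x^-1)
    & forall x y, N x -> N (x ^ y)].

Definition normal_closure (G : groupType) (S : set G) : set G :=
  [set g | forall N : set G, normal_subgroup N -> S `<=` N -> N g].

(* G is isomorphic to the quotient of the free group on X by the normal
   closure of the relators r i. *)
Definition has_presentation (G : groupType) (X : choiceType) (I : Type)
    (r : I -> free_group X) : Prop :=
  exists phi : UMagmaMorphism.type (free_group X) G,
    (forall g, exists w, phi w = g) /\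
    [set w | phi w = 1] = normal_closure (range r).

(* Relators may be trivial or repeated. *)
Definition fg_relator_group (k : nat) (G : groupType) : Prop :=
  exists (m : nat) (r : 'I_k -> free_group 'I_m), has_presentation G r.

End Presentations.

Section GroupRing.
Variable G : groupType.
Local Open Scope fset_scope.
Local Open Scope ring_scope.

(* A formal combination of the elements of G is a finitely supported
   function G -> int. *)
Record group_ring := GroupRing { gr_fun : {fsfun G -> int with 0} }.
HB.instance Definition _ := [isNew for gr_fun].
HB.instance Definition _ := [Choice of group_ring by <:].

Definition gr_coef (a : group_ring) (g : G) : int := gr_fun a g.
Definition gr_supp (a : group_ring) : {fset G} := finsupp (gr_fun a).

Local Notation "a @_ g" := (gr_coef a g) (at level 3, g at level 2).

Lemma grP (a b : group_ring) : (forall g, a@_g = b@_g) -> a = b.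
Proof. by move=> ab; apply: val_inj; apply/fsfunP. Qed.

Lemma gr_outsupp a g : g \notin gr_supp a -> a@_g = 0.
Proof. exact: fsfun_dflt. Qed.

Definition gr_mk (A : {fset G}) (f : G -> int) : group_ring :=
  GroupRing [fsfun g in A => f g].

Lemma gr_mkE A f g : (gr_mk A f)@_g = if g \in A then f g else 0.
Proof. exact/fsfun_fun. Qed.

Definition gr_zero : group_ring := gr_mk fset0 (fun=> 0).
Definition gr_opp a := gr_mk (gr_supp a) (fun g => - a@_g).
Definition gr_add a b :=
  gr_mk (gr_supp a `|` gr_supp b) (fun g => a@_g + b@_g).

Lemma gr_zeroE g : gr_zero@_g = 0. Proof. by rewrite gr_mkE. Qed.

Lemma gr_oppE a g : (gr_opp a)@_g = - a@_g.
Proof. by rewrite gr_mkE; case: ifPn => // /gr_outsupp ->; rewrite oppr0. Qed.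

Lemma gr_addE a b g : (gr_add a b)@_g = a@_g + b@_g.
Proof.
rewrite gr_mkE in_fsetU; case: ifPn => //; rewrite negb_or => /andP[ag bg].
by rewrite !gr_outsupp.
Qed.

Lemma gr_addA : associative gr_add.
Proof. by move=> a b c; apply: grP => g; rewrite !gr_addE addrA. Qed.

Lemma gr_addC : commutative gr_add.
Proof. by move=> a b; apply: grP => g; rewrite !gr_addE addrC. Qed.

Lemma gr_add0r : left_id gr_zero gr_add.
Proof. by move=> a; apply: grP => g; rewrite gr_addE gr_zeroE add0r. Qed.

Lemma gr_addNr : left_inverse gr_zero gr_opp gr_add.
Proof. by move=> a; apply: grP => g; rewrite gr_addE gr_oppE gr_zeroE addNr. Qed.

HB.instance Definition _ :=
  GRing.isZmodule.Build group_ring gr_addA gr_addC gr_add0r gr_addNr.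

Lemma gr_coef0 g : (0 : group_ring)@_g = 0. Proof. exact: gr_zeroE. Qed.
Lemma gr_coefD a b g : (a + b)@_g = a@_g + b@_g. Proof. exact: gr_addE. Qed.
Lemma gr_coefN a g : (- a)@_g = - a@_g. Proof. exact: gr_oppE. Qed.

Lemma gr_coef_sum (I : Type) (s : seq I) (F : I -> group_ring) g :
  (\sum_(i <- s) F i)@_g = \sum_(i <- s) (F i)@_g.
Proof. exact: (big_morph (gr_coef^~ g) (fun a b => gr_coefD a b g) (gr_coef0 g)). Qed.

Definition gr_term (c : int) (g : G) : group_ring := gr_mk [fset g] (fun=> c).

Lemma gr_termE c g h : (gr_term c g)@_h = if h == g then c else 0.
Proof. by rewrite gr_mkE in_fset1. Qed.

Lemma gr_term0 g : gr_term 0 g = 0.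
Proof. by apply: grP => h; rewrite gr_termE gr_coef0 if_same. Qed.

Lemma gr_termD g c d : gr_term (c + d) g = gr_term c g + gr_term d g.
Proof.
by apply: grP => h; rewrite gr_coefD !gr_termE; case: eqP; rewrite ?addr0.
Qed.

Lemma gr_suppE a g : (g \in gr_supp a) = (a@_g != 0).
Proof. by rewrite /gr_supp mem_finsupp. Qed.

Lemma gr_supp_term c g : gr_supp (gr_term c g) `<=` [fset g].
Proof.
by apply/fsubsetP => h; rewrite gr_suppE gr_termE in_fset1; case: (h == g); rewrite ?eqxx.
Qed.

Lemma gr_suppD a b : gr_supp (a + b) `<=` gr_supp a `|` gr_supp b.
Proof.
apply/fsubsetP => g; rewrite in_fsetU; apply: contraLR; rewrite negb_or.
by case/andP=> ag bg; rewrite gr_suppE gr_coefD !gr_outsupp // negbK.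
Qed.

Lemma gr_supp0 : gr_supp 0 = fset0.
Proof. by apply/fsetP => g; rewrite gr_suppE gr_coef0 eqxx in_fset0. Qed.

Lemma gr_expand a : a = \sum_(g <- gr_supp a) gr_term a@_g g.
Proof.
apply: grP => g; rewrite gr_coef_sum; case: (boolP (g \in gr_supp a)) => ga.
  rewrite (big_fsetD1 g) //= gr_termE eqxx big1_fset ?addr0 // => h.
  by rewrite in_fsetD1 gr_termE eq_sym => /andP[/negPf->].
rewrite gr_outsupp // big1_fset // => h ha _; rewrite gr_termE.
by case: eqP ha ga => // <- ->.
Qed.

Definition gr_one : group_ring := gr_term 1 1%g.

Definition gr_mul (a b : group_ring) : group_ring :=
  \sum_(g <- gr_supp a) \sum_(h <- gr_supp b) gr_term (a@_g * b@_h) (g * h)%g.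

Lemma gr_mulw (A B : {fset G}) a b : gr_supp a `<=` A -> gr_supp b `<=` B ->
  gr_mul a b = \sum_(g <- A) \sum_(h <- B) gr_term (a@_g * b@_h) (g * h)%g.
Proof.
move=> sA sB; rewrite /gr_mul (big_fset_incl _ sA) /=; last first.
  move=> g _ /gr_outsupp ag; rewrite big1 // => h _.
  by rewrite ag mul0r gr_term0.
apply: eq_bigr => g _; apply/big_fset_incl => // h _ /gr_outsupp ->.
by rewrite mulr0 gr_term0.
Qed.

Lemma gr_mulDl : left_distributive gr_mul +%R.
Proof.
move=> a b c; pose A := gr_supp a `|` gr_supp b.
rewrite (@gr_mulw A (gr_supp c)) ?gr_suppD //.
rewrite (@gr_mulw A (gr_supp c) a) ?fsubsetUl //.
rewrite (@gr_mulw A (gr_supp c) b) ?fsubsetUr //.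
rewrite -big_split /=; apply: eq_bigr => g _.
rewrite -big_split /=; apply: eq_bigr => h _.
by rewrite gr_coefD mulrDl gr_termD.
Qed.

Lemma gr_mulDr : right_distributive gr_mul +%R.
Proof.
move=> c a b; pose A := gr_supp a `|` gr_supp b.
rewrite (@gr_mulw (gr_supp c) A) ?gr_suppD //.
rewrite (@gr_mulw (gr_supp c) A c a) ?fsubsetUl //.
rewrite (@gr_mulw (gr_supp c) A c b) ?fsubsetUr //.
rewrite -big_split /=; apply: eq_bigr => g _.
rewrite -big_split /=; apply: eq_bigr => h _.
by rewrite gr_coefD mulrDr gr_termD.
Qed.

Lemma gr_mul0 : right_zero 0 gr_mul.
Proof. by move=> a; rewrite /gr_mul gr_supp0 big1 // => g _; rewrite big_seq_fset0. Qed.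

Lemma gr_0mul : left_zero 0 gr_mul.
Proof. by move=> a; rewrite /gr_mul gr_supp0 big_seq_fset0. Qed.

Lemma gr_mul_term c d g h :
  gr_mul (gr_term c g) (gr_term d h) = gr_term (c * d) (g * h)%g.
Proof.
by rewrite (gr_mulw (gr_supp_term _ _) (gr_supp_term _ _)) !big_seq_fset1 !gr_termE !eqxx.
Qed.

Lemma gr_mul_suml (I : Type) (s : seq I) (F : I -> group_ring) b :
  gr_mul (\sum_(i <- s) F i) b = \sum_(i <- s) gr_mul (F i) b.
Proof. exact: (big_morph (gr_mul^~ b) (fun _ _ => gr_mulDl _ _ _) (gr_0mul b)). Qed.

Lemma gr_mul_sumr (I : Type) (s : seq I) (F : I -> group_ring) a :
  gr_mul a (\sum_(i <- s) F i) = \sum_(i <- s) gr_mul a (F i).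
Proof. exact: (big_morph (gr_mul a) (fun _ _ => gr_mulDr _ _ _) (gr_mul0 a)). Qed.

Lemma gr_mulA : associative gr_mul.
Proof.
move=> a b c; rewrite [a]gr_expand !gr_mul_suml; apply: eq_bigr => g _.
rewrite [b]gr_expand gr_mul_suml !gr_mul_sumr gr_mul_suml.
apply: eq_bigr => h _; rewrite [c]gr_expand !gr_mul_sumr; apply: eq_bigr => k _.
by rewrite !gr_mul_term mulrA mulgA.
Qed.

Lemma gr_mul1r : left_id gr_one gr_mul.
Proof.
move=> a; rewrite [a]gr_expand gr_mul_sumr; apply: eq_bigr => g _.
by rewrite gr_mul_term mul1r mul1g.
Qed.

Lemma gr_mulr1 : right_id gr_one gr_mul.
Proof.
move=> a; rewrite [a]gr_expand gr_mul_suml; apply: eq_bigr => g _.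
by rewrite gr_mul_term mulr1 mulg1.
Qed.

Lemma gr_oner_neq0 : gr_one != 0.
Proof.
by apply/eqP => /(congr1 (gr_coef^~ 1%g)); rewrite gr_termE eqxx gr_coef0.
Qed.

HB.instance Definition _ := GRing.Zmodule_isNzRing.Build group_ring
  gr_mulA gr_mul1r gr_mulr1 gr_mulDl gr_mulDr gr_oner_neq0.

Definition augmentation (a : group_ring) : int := \sum_(g <- gr_supp a) a@_g.

Lemma augmentationw (A : {fset G}) a : gr_supp a `<=` A ->
  augmentation a = \sum_(g <- A) a@_g.
Proof.
by move=> sA; rewrite /augmentation (big_fset_incl _ sA) // => g _ /gr_outsupp.
Qed.

Lemma augmentation_term c g : augmentation (gr_term c g) = c.
Proof. by rewrite (augmentationw (gr_supp_term c g)) big_seq_fset1 gr_termE eqxx. Qed.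

Lemma augmentationD a b : augmentation (a + b) = augmentation a + augmentation b.
Proof.
rewrite (augmentationw (gr_suppD a b)) (augmentationw (fsubsetUl _ (gr_supp b))).
rewrite (augmentationw (fsubsetUr (gr_supp a) _)) -big_split /=.
by apply: eq_bigr => g _; rewrite gr_coefD.
Qed.

Lemma augmentation0 : augmentation 0 = 0.
Proof. by rewrite /augmentation gr_supp0 big_seq_fset0. Qed.

Lemma augmentation_sum (I : Type) (s : seq I) (F : I -> group_ring) :
  augmentation (\sum_(i <- s) F i) = \sum_(i <- s) augmentation (F i).
Proof. exact: (big_morph augmentation augmentationD augmentation0). Qed.

Lemma augmentationM a b : augmentation (a * b) = augmentation a * augmentation b.
Proof.
rewrite {1}/GRing.mul /= /gr_mul augmentation_sum mulr_suml.
apply: eq_bigr => g _; rewrite augmentation_sum mulr_sumr.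
by apply: eq_bigr => h _; rewrite augmentation_term.
Qed.

Lemma augmentation1 : augmentation 1 = 1.
Proof. exact: augmentation_term. Qed.

End GroupRing.

(* The trivial module: every g in G acts as the identity of the additive
   group int. *)
Definition trivial_module (G : groupType) : Type := int.
HB.instance Definition _ (G : groupType) := GRing.Zmodule.on (trivial_module G).

Section TrivialModule.
Variable G : groupType.
Local Open Scope ring_scope.

Implicit Types (a b : group_ring G) (y z : trivial_module G).

Definition triv_scale a z : trivial_module G :=
  augmentation a * (z : int).

Lemma triv_scaleA a b z : triv_scale a (triv_scale b z) = triv_scale (a * b) z.
Proof. by rewrite /triv_scale augmentationM mulrA. Qed.

Lemma triv_scale1 : left_id 1 triv_scale.
Proof. by move=> z; rewrite /triv_scale augmentation1 mul1r. Qed.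

Lemma triv_scaleDr : right_distributive triv_scale +%R.
Proof. by move=> a y z; exact: mulrDr. Qed.

Lemma triv_scaleDl z : {morph triv_scale^~ z : a b / a + b}.
Proof. by move=> a b; rewrite /triv_scale augmentationD; exact: mulrDl. Qed.

HB.instance Definition _ := GRing.Zmodule_isLmodule.Build (group_ring G)
  (trivial_module G) triv_scaleA triv_scale1 triv_scaleDr triv_scaleDl.

End TrivialModule.

Section CohomologicalDimension.
Local Open Scope ring_scope.

Definition projective (R : nzRingType) (P : lmodType R) : Prop :=
  forall (M N : lmodType R) (p : {linear M -> N}) (f : {linear P -> N}),
    (forall y, exists x, p x = y) ->
    exists h : {linear P -> M}, forall x, p (h x) = f x.

(* ... -> P 2 -> P 1 -> P 0 -> M -> 0 *)
Record proj_resolution (R : nzRingType) (M : lmodType R) := ProjResolution {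
  res_mod : nat -> lmodType R;
  res_diff : forall i, {linear res_mod i.+1 -> res_mod i};
  res_aug : {linear res_mod 0 -> M};
  res_proj : forall i, projective (res_mod i);
  res_aug_surj : forall y, exists x, res_aug x = y;
  res_exact0 : forall x, res_aug x = 0 <-> exists y, res_diff 0 y = x;
  res_exactS : forall i x,
    res_diff i x = 0 <-> exists y, res_diff i.+1 y = x
}.

(* P is of the form 0 -> P n -> ... -> P 0 -> M -> 0. *)
Definition res_length (R : nzRingType) (M : lmodType R)
    (P : proj_resolution M) (n : nat) : Prop :=
  forall i, (n < i)%N -> forall x : res_mod P i, x = 0.

(* The cohomological dimension is the least length of a projective resolution
   of the trivial module, so it is at most n when some length m <= n occurs. *)
Definition cohomological_dimension_le (G : groupType) (n : nat) : Prop :=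
  exists (m : nat) (P : proj_resolution (trivial_module G)),
    (m <= n)%N /\ res_length P m.

End CohomologicalDimension.

Section Hyperbolic.
Local Open Scope ring_scope.
Variables (R : realType) (n : nat).

(* The form - x_0 y_0 + x_1 y_1 + ... + x_n y_n on R^(n+1). *)
Definition lorentz (x y : 'rV[R]_n.+1) : R :=
  - (x 0 ord0 * y 0 ord0) + \sum_(i < n) x 0 (lift ord0 i) * y 0 (lift ord0 i).

(* The hyperboloid model of hyperbolic n-space of curvature -1. *)
Record hyperbolic_space := HyperbolicPoint {
  hyp_val :> 'rV[R]_n.+1;
  hyp_lorentz : lorentz hyp_val hyp_val = -1;
  hyp_gt0 : 0 < hyp_val 0 ord0
}.

Definition arcosh (x : R) : R := ln (x + Num.sqrt (x ^+ 2 - 1)).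

Definition hyp_dist (p q : hyperbolic_space) : R := arcosh (- lorentz p q).

End Hyperbolic.

Record isometric_action (R : realType) (n : nat) (G : groupType) :=
  IsometricAction {
    act :> G -> hyperbolic_space R n -> hyperbolic_space R n;
    act1 : forall p, act 1%g p = p;
    actM : forall g h p, act (g * h)%g p = act g (act h p);
    act_isometry : forall g p q, hyp_dist (act g p) (act g q) = hyp_dist p q
  }.

(* An infimum in the extended reals; it is +oo for the trivial group. *)
Definition infimum_displacement (R : realType) (n : nat) (G : groupType)
    (a : isometric_action R n G) : \bar R :=
  ereal_inf [set (hyp_dist x.1 (a x.2 x.1))%:E
            | x in [set x : hyperbolic_space R n * G | x.2 <> 1%g]]%classic.

(* Main.v *)
Require Import Defs.
From HB Require Import structures.
From mathcomp Require Import all_boot all_order all_algebra finmap.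
From mathcomp Require Import boolp classical_sets reals constructive_ereal ereal exp.
From mathcomp Require Import ring lra zify.

(** The Fox derivatives of the two relators present the kernel K of
    Z[G]^m -> Z[G] as the image of a map U : Z[G]^2 -> Z[G]^m, so it suffices to
    split off N = ker U.

    Fix a prime p, or p = 0, and a relation al u1 + be u2 = 0 modulo p between
    the rows of U. Place the support of each row on the orbit of a base point,
    and give it as center the midpoint of a diametral pair. At the point of the
    translates of supports that is farthest from the base point, exactly one
    translate g u1 and one translate h u2 meet: two translates of the same row
    would have nearby centers there, against the large displacement. If u2 is
    the wider row, adding to be_h u2 the suitable combination of translates of
    u1 kills every deep point of h u2, and what remains has smaller diameter.
    Iterating this Euclidean algorithm, N splits modulo every prime and
    rationally.

    A rational splitting gives an integral map Z[G]^2 -> N that is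
    multiplication by some s <> 0 on N. The splittings modulo the primes
    dividing s lift, because K is the kernel of Z[G]^m -> Z[G], and combine to a
    splitting modulo s, which corrects the rational one to an integral one. *)

Set Implicit Arguments.
Unset Strict Implicit.
Unset Printing Implicit Defensive.

Import Order.TTheory GRing.Theory Num.Theory.

(** * Coarse geometry of hyperbolic space *)

Section HyperbolicDistance.
Local Open Scope ring_scope.
Variables (R : realType) (n : nat).
Implicit Types (x y v : 'rV[R]_n.+1) (p q w z : hyperbolic_space R n).

Lemma lorentzC x y : lorentz x y = lorentz y x.
Proof.
rewrite /lorentz; congr (- _ + _); first exact: mulrC.
by apply: eq_bigr => i _; exact: mulrC.
Qed.

Lemma lorentzDl x y v : lorentz (x + y) v = lorentz x v + lorentz y v.
Proof.
rewrite /lorentz mxE; under eq_bigr do rewrite mxE mulrDl.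
by rewrite big_split /=; ring.
Qed.

Lemma lorentzZl c x v : lorentz (c *: x) v = c * lorentz x v.
Proof.
rewrite /lorentz mxE; under eq_bigr do rewrite mxE -mulrA.
by rewrite -mulr_sumr; ring.
Qed.

Lemma lorentzDr x y v : lorentz v (x + y) = lorentz v x + lorentz v y.
Proof. by rewrite !(lorentzC v) lorentzDl. Qed.

Lemma lorentzZr c x v : lorentz v (c *: x) = c * lorentz v x.
Proof. by rewrite !(lorentzC v) lorentzZl. Qed.

(** Cauchy-Schwarz on the spatial coordinates without division: the expression is the sum of the
    squares of [a * x_i - b * y_i]. *)
Lemma sqr_comb_ge0 x y (a b : R) :
  0 <= a ^+ 2 * (lorentz x x + x 0 ord0 ^+ 2)
     - 2 * a * b * (lorentz x y + x 0 ord0 * y 0 ord0)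
     + b ^+ 2 * (lorentz y y + y 0 ord0 ^+ 2).
Proof.
rewrite /lorentz.
have -> (c d : R) : - (c * c) + d + c ^+ 2 = d by ring.
have -> (c d : R) : - (c * c) + d + c ^+ 2 = d by ring.
have -> (c d : R) : - c + d + c = d by ring.
rewrite !mulr_sumr -sumrB -big_split /=; apply: sumr_ge0 => i _.
set s := x _ _; set t := y _ _.
have -> : a ^+ 2 * (s * s) - 2 * a * b * (s * t) + b ^+ 2 * (t * t) =
  (a * s - b * t) ^+ 2 by ring.
exact: sqr_ge0.
Qed.

(** With [a = z_0] and [b = v_0], [sqr_comb_ge0] reads [v_0^2 <= z_0^2 * lorentz v v]: the
    complement of a timelike vector is spacelike. *)
Lemma lorentz_orth_ge0 v z : lorentz v z = 0 -> 0 <= lorentz v v.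
Proof.
move=> vz; have := sqr_comb_ge0 v z (z 0%R 0%R) (v 0%R 0%R).
rewrite vz hyp_lorentz; set z0 := z 0%R 0%R; set v0 := v 0%R 0%R; set L := lorentz v v.
have z0gt : 0 < z0 ^+ 2 by rewrite exprn_gt0 // /z0; exact: hyp_gt0.
have -> : z0 ^+ 2 * (L + v0 ^+ 2) - 2 * z0 * v0 * (0 + v0 * z0)
  + v0 ^+ 2 * (-1 + z0 ^+ 2) = z0 ^+ 2 * L - v0 ^+ 2 by ring.
rewrite subr_ge0 => h; have := le_trans (sqr_ge0 _) h.
by rewrite pmulr_rge0.
Qed.

Definition hyp_cosh p q : R := - lorentz p q.

Lemma hyp_coshxx p : hyp_cosh p p = 1.
Proof. by rewrite /hyp_cosh hyp_lorentz opprK. Qed.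

Lemma hyp_cosh_ge1 p q : 1 <= hyp_cosh p q.
Proof.
have gt0 : 0 < hyp_cosh p q.
  rewrite oppr_gt0 ltNge; apply/negP => pq.
  have := sqr_comb_ge0 p q (q 0%R 0%R) (p 0%R 0%R); rewrite !hyp_lorentz.
  have := hyp_gt0 p; have := hyp_gt0 q; set s := p 0%R 0%R; set t := q 0%R 0%R.
  move: (lorentz _ _) pq => L L0 t0 s0.
  have st : 0 < s * t by exact: mulr_gt0.
  have : 0 <= (s * t) * L by rewrite mulr_ge0 // ltW.
  have : 0 < s ^+ 2 by rewrite exprn_gt0.
  have : 0 < t ^+ 2 by rewrite exprn_gt0.
  have -> : t ^+ 2 * (-1 + s ^+ 2) - 2 * t * s * (L + s * t) + s ^+ 2 * (-1 + t ^+ 2)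
    = - t ^+ 2 - s ^+ 2 - 2 * (s * t * L) by ring.
  lra.
(* The component of [q] orthogonal to [p] has square [hyp_cosh p q ^ 2 - 1]. *)
have : 0 <= lorentz (hyp_val q + (- hyp_cosh p q) *: hyp_val p)
                     (hyp_val q + (- hyp_cosh p q) *: hyp_val p).
  apply: (@lorentz_orth_ge0 _ p).
  by rewrite lorentzDl lorentzZl hyp_lorentz (lorentzC q) /hyp_cosh; ring.
rewrite !(lorentzDl, lorentzZl, lorentzDr, lorentzZr) !hyp_lorentz (lorentzC q).
move: gt0; rewrite /hyp_cosh; set L := lorentz _ _ => gt0.
have -> : -1 + - - L * L + (- - L * L + - - L * (- - L * -1)) = (- L - 1) * (- L + 1) by ring.
rewrite pmulr_lge0; last lra.
lra.
Qed.

(** The vector [v] is orthogonal to [z], so [lorentz v v >= 0]; expand, drop the squares and divide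
    by [2 * a * b * c]. This is a multiplicative four-point condition. *)
Lemma hyp_cosh_four p q w z : hyp_cosh p q * hyp_cosh w z <=
  2 * (hyp_cosh p w * hyp_cosh q z + hyp_cosh w q * hyp_cosh p z).
Proof.
have := hyp_cosh_ge1 p z; have := hyp_cosh_ge1 q z; have := hyp_cosh_ge1 w z.
set a := hyp_cosh p z; set b := hyp_cosh q z; set c := hyp_cosh w z => c1 b1 a1.
pose v := (b * c) *: hyp_val p + (a * c) *: hyp_val q + (- 2 * a * b) *: hyp_val w.
have : 0 <= lorentz v v.
  apply: (@lorentz_orth_ge0 _ z).
  rewrite !(lorentzDl, lorentzZl).
  have -> : lorentz p z = - a by rewrite opprK.
  have -> : lorentz q z = - b by rewrite opprK.
  have -> : lorentz w z = - c by rewrite opprK.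
  ring.
rewrite !(lorentzDl, lorentzZl, lorentzDr, lorentzZr) !hyp_lorentz.
rewrite (lorentzC q p) (lorentzC w p) (lorentzC q w) /hyp_cosh.
move: (lorentz p q) (lorentz p w) (lorentz w q) => X Y Z H.
have abc : 0 < 2 * (a * b * c) by do ?apply: mulr_gt0; lra.
rewrite -(ler_pM2l abc).
have := sqr_ge0 (b * c); have := sqr_ge0 (a * c); have := sqr_ge0 (a * b).
nra.
Qed.

(** From [x <= x + sqrt (x^2 - 1) <= 2 * x] and [ln 2 <= 1]. *)
Lemma hyp_dist_bounds p q :
  ln (hyp_cosh p q) <= hyp_dist p q <= 1 + ln (hyp_cosh p q).
Proof.
have x1 := hyp_cosh_ge1 p q; rewrite /hyp_dist /arcosh -/(hyp_cosh p q).
have s0 := sqrtr_ge0 (hyp_cosh p q ^+ 2 - 1).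
have sx : Num.sqrt (hyp_cosh p q ^+ 2 - 1) <= hyp_cosh p q.
  rewrite -[leRHS](@ger0_norm _ _ (le_trans ler01 x1)) -sqrtr_sqr ler_wsqrtr //.
  lra.
apply/andP; split; first by rewrite ler_ln ?posrE; lra.
have ln2 : ln (1 + 1 : R) <= 1 by apply: le_ln1Dx; lra.
apply: le_trans (lerD ln2 (lexx _)).
rewrite -lnM ?posrE; [|lra|lra].
by rewrite ler_ln ?posrE; lra.
Qed.

Lemma hyp_dist_ge0 p q : 0 <= hyp_dist p q.
Proof.
have /andP[+ _] := hyp_dist_bounds p q.
exact/le_trans/ln_ge0/hyp_cosh_ge1.
Qed.

Lemma hyp_distC p q : hyp_dist p q = hyp_dist q p.
Proof. by rewrite /hyp_dist lorentzC. Qed.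

(** Logarithm of [hyp_cosh_four], whose right side is at most 4 times the larger product. The
    additive 4 is the bound 2 for [ln 4] plus 1 for each distance on the left. *)
Lemma hyp_dist_four p q w z :
  hyp_dist p q + hyp_dist w z <= 4 + (hyp_dist p w + hyp_dist q z) \/
  hyp_dist p q + hyp_dist w z <= 4 + (hyp_dist w q + hyp_dist p z).
Proof.
have /andP[_ pq] := hyp_dist_bounds p q; have /andP[_ wz] := hyp_dist_bounds w z.
have /andP[pw _] := hyp_dist_bounds p w; have /andP[qz _] := hyp_dist_bounds q z.
have /andP[wq _] := hyp_dist_bounds w q; have /andP[pz _] := hyp_dist_bounds p z.
have gt0 a b : 0 < hyp_cosh a b by exact: lt_le_trans ltr01 (hyp_cosh_ge1 a b).
have ln4 (r : R) : 0 < r -> ln (4 * r) <= 2 + ln r.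
  move=> r0; have -> : 4 = (1 + 1) * (1 + 1) :> R by ring.
  have h2 : ln (1 + 1 : R) <= 1 by apply: le_ln1Dx; lra.
  by rewrite -mulrA !lnM ?posrE; lra.
have lnc a b a' b' : ln (hyp_cosh a b * hyp_cosh a' b') =
    ln (hyp_cosh a b) + ln (hyp_cosh a' b') by rewrite lnM ?posrE.
have four := hyp_cosh_four p q w z.
set A := hyp_cosh p w * hyp_cosh q z in four.
set B := hyp_cosh w q * hyp_cosh p z in four.
have [AB|AB] := leP A B; [right|left].
- have : ln (hyp_cosh p q * hyp_cosh w z) <= ln (4 * B).
    by rewrite ler_ln ?posrE ?mulr_gt0 //; lra.
  have := ln4 B (mulr_gt0 (gt0 _ _) (gt0 _ _)).
  rewrite !lnc; lra.
- have : ln (hyp_cosh p q * hyp_cosh w z) <= ln (4 * A).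
    by rewrite ler_ln ?posrE ?mulr_gt0 //; lra.
  have := ln4 A (mulr_gt0 (gt0 _ _) (gt0 _ _)).
  rewrite !lnc; lra.
Qed.

Lemma hyp_midpoint p q : exists c : hyperbolic_space R n,
  2 * hyp_dist p c <= 2 + hyp_dist p q /\ 2 * hyp_dist q c <= 2 + hyp_dist p q.
Proof.
have x1 := hyp_cosh_ge1 p q; set x := hyp_cosh p q in x1.
have pqE : lorentz p q = - x by rewrite /x /hyp_cosh opprK.
(* The midpoint is [p + q] rescaled to the hyperboloid: [lorentz (p + q) (p + q) = - s^2]. *)
pose s := Num.sqrt (2 + 2 * x).
have s0 : 0 < s by rewrite sqrtr_gt0; lra.
have s2 : s ^+ 2 = 2 + 2 * x by rewrite sqr_sqrtr //; lra.
have sn0 : s != 0 by rewrite gt_eqF.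
pose v := s^-1 *: (hyp_val p + hyp_val q).
have vL : lorentz v v = -1.
  rewrite /v !(lorentzZl, lorentzZr, lorentzDl, lorentzDr) !hyp_lorentz (lorentzC q) pqE.
  by apply: (mulfI (expf_neq0 2 sn0)); rewrite [in RHS]s2; field.
have v0 : 0 < v 0 ord0.
  by rewrite !mxE mulr_gt0 ?invr_gt0 // addr_gt0 // hyp_gt0.
exists (HyperbolicPoint vL v0); set c := HyperbolicPoint _ _.
have /andP[lpq _] := hyp_dist_bounds p q.
have /andP[_ lpc] := hyp_dist_bounds p c; have /andP[_ lqc] := hyp_dist_bounds q c.
(* Here [hyp_cosh a c ^ 2 = (1 + x) / 2 <= x]. *)
have key a : hyp_cosh a c = s^-1 * (1 + x) -> ln (hyp_cosh a c) *+ 2 <= ln x.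
  move=> ac; have a1 := hyp_cosh_ge1 a c.
  rewrite -lnXn; last lra.
  rewrite ler_ln ?posrE; [|by rewrite exprn_gt0; lra|lra].
  rewrite ac exprMn exprVn s2 -(@ler_pM2l _ (2 + 2 * x)); last lra.
  rewrite mulrA divff ?mul1r; last lra.
  have : 0 <= (x - 1) * (x + 1) by rewrite mulr_ge0; lra.
  nra.
have kp : hyp_cosh p c = s^-1 * (1 + x).
  by rewrite /hyp_cosh /= /v lorentzZr lorentzDr hyp_lorentz pqE; ring.
have kq : hyp_cosh q c = s^-1 * (1 + x).
  by rewrite /hyp_cosh /= /v lorentzZr lorentzDr hyp_lorentz lorentzC pqE; ring.
have := key p kp; have := key q kq; rewrite -/x in lpq; rewrite !mulr2n; lra.
Qed.

Lemma hyp_distxx p : hyp_dist p p = 0.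
Proof. by rewrite /hyp_dist -/(hyp_cosh p p) hyp_coshxx /arcosh expr1n subrr sqrtr0 addr0 ln1. Qed.

Lemma hyp_origin_lorentz :
  lorentz (delta_mx 0 ord0 : 'rV[R]_n.+1) (delta_mx 0 ord0) = -1.
Proof.
rewrite /lorentz !mxE !eqxx big1 ?addr0 ?mulr1 // => i _.
by rewrite !mxE mulr0.
Qed.

Lemma hyp_origin_gt0 : 0 < (delta_mx 0 ord0 : 'rV[R]_n.+1) 0 ord0.
Proof. by rewrite mxE !eqxx ltr01. Qed.

Definition hyp_origin : hyperbolic_space R n :=
  HyperbolicPoint hyp_origin_lorentz hyp_origin_gt0.

(* Integral distances make every inequality below a matter of linear integer
   arithmetic; rounding only costs a bounded additive error. *)
Definition hyp_ndist p q : nat := Num.truncn (hyp_dist p q).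

Lemma hyp_ndistC p q : hyp_ndist p q = hyp_ndist q p.
Proof. by rewrite /hyp_ndist hyp_distC. Qed.

Lemma hyp_ndistxx p : hyp_ndist p p = 0%N.
Proof. by rewrite /hyp_ndist hyp_distxx truncn0. Qed.

Lemma hyp_ndist_bounds p q :
  (hyp_ndist p q)%:R <= hyp_dist p q < (hyp_ndist p q)%:R + 1.
Proof. by rewrite natr1 truncn_itv // hyp_dist_ge0. Qed.

Lemma hyp_ndist_four p q w z :
  (hyp_ndist p q + hyp_ndist w z <= hyp_ndist p w + hyp_ndist q z + 6)%N \/
  (hyp_ndist p q + hyp_ndist w z <= hyp_ndist w q + hyp_ndist p z + 6)%N.
Proof.
have /andP[h1 _] := hyp_ndist_bounds p q; have /andP[h2 _] := hyp_ndist_bounds w z.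
have /andP[_ h3] := hyp_ndist_bounds p w; have /andP[_ h4] := hyp_ndist_bounds q z.
have /andP[_ h5] := hyp_ndist_bounds w q; have /andP[_ h6] := hyp_ndist_bounds p z.
by case: (hyp_dist_four p q w z) => h; [left|right];
  rewrite -(ler_nat R) !natrD; lra.
Qed.

Lemma hyp_nmidpoint p q : exists c : hyperbolic_space R n,
  (2 * hyp_ndist p c <= hyp_ndist p q + 6)%N /\
  (2 * hyp_ndist q c <= hyp_ndist p q + 6)%N.
Proof.
have [c [pc qc]] := hyp_midpoint p q; exists c.
have /andP[_ h1] := hyp_ndist_bounds p q.
have /andP[h2 _] := hyp_ndist_bounds p c; have /andP[h3 _] := hyp_ndist_bounds q c.
by rewrite -!(ler_nat R) !natrM !natrD; split; lra.
Qed.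

End HyperbolicDistance.

(** * Reduction of relations *)

Lemma ex_max_bounded (T : Type) (f : T -> nat) (Q : T -> Prop) (N : nat) :
  (exists x, Q x) -> (forall x, Q x -> f x <= N) ->
  exists x, Q x /\ forall y, Q y -> f y <= f x.
Proof.
move=> [x0 Qx0] bd; apply: contrapT => nomax.
have grow k : exists x, Q x /\ k <= f x.
  elim: k => [|k [x [Qx kx]]]; first by exists x0.
  apply: contrapT => h; apply: nomax; exists x; split=> // y Qy.
  rewrite leqNgt; apply/negP => xy; apply: h; exists y; split=> //.
  exact: leq_ltn_trans xy.
by have [x [Qx]] := grow N.+1; rewrite ltnNge bd.
Qed.

Lemma ex_bound_seq (T : eqType) (f : T -> nat) (L : seq T) :
  exists N, forall x, x \in L -> f x <= N.
Proof.
elim: L => [|x L [N IH]]; first by exists 0.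
exists (maxn (f x) N) => y; rewrite inE leq_max => /orP[/eqP->|/IH->].
  by rewrite leqnn.
by rewrite orbT.
Qed.

(* The constant 6 covers both the hyperbolicity constant of H^n and the
   rounding of its distance. *)
Record coarse_action (G : groupType) := CoarseAction {
  ca_pt : Type;
  ca_base : ca_pt;
  ca_dist : ca_pt -> ca_pt -> nat;
  ca_act : G -> ca_pt -> ca_pt;
  ca_distC : forall p q, ca_dist p q = ca_dist q p;
  ca_distxx : forall p, ca_dist p p = 0;
  ca_four : forall p q w z,
    ca_dist p q + ca_dist w z <= ca_dist p w + ca_dist q z + 6 \/
    ca_dist p q + ca_dist w z <= ca_dist w q + ca_dist p z + 6;
  ca_midpoint : forall p q, exists c,
    2 * ca_dist p c <= ca_dist p q + 6 /\ 2 * ca_dist q c <= ca_dist p q + 6;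
  ca_act1 : forall p, ca_act 1%g p = p;
  ca_actM : forall g h p, ca_act (g * h)%g p = ca_act g (ca_act h p);
  ca_act_isometry : forall g p q, ca_dist (ca_act g p) (ca_act g q) = ca_dist p q;
  ca_displacement : forall g p, g <> 1%g -> 2000 <= ca_dist p (ca_act g p)
}.

(** * Supports of rows on an orbit *)

Section Step.
Variables (G : groupType) (X : coarse_action G) (m : nat) (p : int).
(** This form of primality admits [p = 0], where divisibility means vanishing, so the rational and
    modular cases are treated together. *)
Hypothesis p_prime : forall a b : int, (p %| (a * b)%R)%Z -> (p %| a)%Z || (p %| b)%Z.
Local Open Scope ring_scope.
Local Notation d := (@ca_dist G X).
Local Notation act := (@ca_act G X).
Local Notation R := (group_ring G).
Implicit Types (a b al be : R) (u v : 'rV[R]_m) (s t : G * 'I_m) (g h : G).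
Implicit Types (q c x y : ca_pt X).

Definition gshift g s : G * 'I_m := ((g * s.1)%g, s.2).

Lemma gshiftK g : cancel (gshift g) (gshift g^-1).
Proof. by case=> h i; rewrite /gshift /= mulKg. Qed.

Lemma gshiftVK g : cancel (gshift g^-1) (gshift g).
Proof. by case=> h i; rewrite /gshift /= mulVKg. Qed.

Definition pos s : ca_pt X := act s.1 (ca_base X).

Lemma pos_gshift g s : pos (gshift g s) = act g (pos s).
Proof. by rewrite /pos ca_actM. Qed.

(** A row is read as a finitely supported function on [G * 'I_m], whose points [pos] places on the
    orbit of the base point. *)
Definition rcoef u s : int := gr_coef (u 0 s.2) s.1.

Lemma rcoefD u v s : rcoef (u + v) s = rcoef u s + rcoef v s.
Proof. by rewrite /rcoef mxE gr_coefD. Qed.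

Lemma gr_coefM a b g :
  gr_coef (a * b) g = \sum_(h <- gr_supp a) gr_coef a h * gr_coef b (h^-1 * g)%g.
Proof.
rewrite {1}/GRing.mul /= /gr_mul gr_coef_sum; apply: eq_bigr => h _.
rewrite gr_coef_sum; under eq_bigr do rewrite gr_termE.
have [hb|hb] := boolP ((h^-1 * g)%g \in gr_supp b).
  rewrite (big_fsetD1 _ hb) /= mulVKg eqxx big1_fset ?addr0 // => k.
  rewrite in_fsetD1 => /andP[kh _] _; case: eqP => // gE.
  by rewrite gE mulKg eqxx in kh.
rewrite (gr_outsupp hb) mulr0 big1_fset // => k kb _; case: eqP => // gE.
by rewrite gE mulKg kb in hb.
Qed.

Lemma rcoefZ a u s :
  rcoef (a *: u) s = \sum_(g <- gr_supp a) gr_coef a g * rcoef u (gshift g^-1 s).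
Proof. by rewrite /rcoef mxE gr_coefM. Qed.

Lemma rcoef_term1 u k s : rcoef (gr_term 1 k *: u) s = rcoef u (gshift k^-1 s).
Proof.
have k1 : k \in gr_supp (gr_term 1 k) by rewrite gr_suppE gr_termE eqxx.
rewrite rcoefZ (big_fsetD1 _ k1) /= big1_fset ?addr0.
  by rewrite gr_termE eqxx mul1r.
by move=> h; rewrite in_fsetD1 => /andP[hg _] _; rewrite gr_termE (negPf hg) mul0r.
Qed.

Lemma gr_coefMz a (b : int) g : gr_coef (a *~ b) g = gr_coef a g *~ b.
Proof.
have H n : gr_coef (a *+ n) g = gr_coef a g *+ n.
  by elim: n => [|n IH]; rewrite ?mulr0n ?gr_coef0 // !mulrS gr_coefD IH.
by case: b => n; rewrite ?NegzE ?mulrNz ?gr_coefN -!pmulrn H.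
Qed.

Lemma gr_term_int (b : int) : gr_term b 1 = b%:~R :> R.
Proof.
apply: grP => g; rewrite gr_coefMz !gr_termE; case: eqP; rewrite ?mul0rz //.
by rewrite intz.
Qed.

Definition in_supp u s : Prop := ~~ (p %| rcoef u s)%Z.

Definition hit a u g s : Prop :=
  ~~ (p %| gr_coef a g)%Z /\ in_supp u (gshift g^-1 s).

Lemma coef_hit a u s : ~~ (p %| rcoef (a *: u) s)%Z -> exists g, hit a u g s.
Proof.
move=> nz; apply: contrapT => nohit; case/negP: nz; rewrite rcoefZ.
rewrite big_seq; apply: rpred_sum => g _; rewrite -[_ \in _]negbK; apply/negP => nz.
apply: nohit; exists g; split.
  by apply: contra nz => h; exact: dvdz_mulr.
by apply: contra nz => h; exact: dvdz_mull.
Qed.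

(** Once the term of [g] is removed from [a], nothing hits [s]; the coefficient is then a single
    product modulo [p], nonzero by primality. *)
Lemma coef_uniq_hit a u g s : hit a u g s -> (forall h, hit a u h s -> h = g) ->
  ~~ (p %| rcoef (a *: u) s)%Z.
Proof.
move=> [ag us] uniqg; pose a1 := gr_term (gr_coef a g) g.
have d1 : (p %| rcoef ((a - a1) *: u) s)%Z.
  apply/negPn/negP => /coef_hit[h [ah uh]].
  have hg : h != g.
    apply/eqP => hg; move: ah; rewrite gr_coefD gr_coefN gr_termE hg eqxx subrr.
    by rewrite dvdz0.
  case/eqP: hg; apply: uniqg; split=> //.
  apply: contra ah; rewrite gr_coefD gr_coefN gr_termE.
  case: eqP => [->|_]; first by rewrite subrr dvdz0.
  by rewrite subr0.
have -> : a = (a - a1) + a1 by rewrite subrK.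
rewrite scalerDl rcoefD rpredDl // rcoefZ.
have ga1 : g \in gr_supp a1.
  by rewrite gr_suppE gr_termE eqxx; apply: contra ag => /eqP->; rewrite dvdz0.
rewrite (big_fsetD1 _ ga1) /= big1_fset ?addr0.
  rewrite gr_termE eqxx; apply/negP => /p_prime/orP[]; exact/negP.
move=> h; rewrite in_fsetD1 => /andP[hg _] _.
by rewrite gr_termE (negPf hg) mul0r.
Qed.

Definition supp_seq u : seq (G * 'I_m) :=
  flatten [seq [seq (g, i) | g <- gr_supp (u 0 i)] | i <- enum 'I_m].

Lemma mem_supp_seq u s : in_supp u s -> s \in supp_seq u.
Proof.
move=> us; apply/flattenP; exists [seq (g, s.2) | g <- gr_supp (u 0 s.2)].
  by apply/mapP; exists s.2; rewrite ?mem_enum.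
apply/mapP; exists s.1; last by case: (s).
by rewrite gr_suppE; apply: contra us => /eqP h; rewrite /rcoef h dvdz0.
Qed.

Lemma hit_bounded (f : G * 'I_m -> nat) a u :
  exists N, forall g s, hit a u g s -> (f s <= N)%N.
Proof.
have [N NE] := ex_bound_seq f
  [seq gshift g s | g <- gr_supp a, s <- supp_seq u].
exists N => g s [ag us]; apply: NE; apply/allpairsP; exists (g, gshift g^-1 s).
rewrite /= gshiftVK; split=> //; last exact: mem_supp_seq.
by rewrite gr_suppE; apply: contra ag => /eqP->; rewrite dvdz0.
Qed.

(* The bound is strict so that [extent u 0] means that u vanishes modulo p. *)
Definition extent u (D : nat) : Prop :=
  forall s t, in_supp u s -> in_supp u t -> (d (pos s) (pos t) < D)%N.

Lemma extent_exists u : exists D, extent u D.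
Proof.
have [N NE] := ex_bound_seq (fun st => d (pos st.1) (pos st.2))
  [seq (s, t) | s <- supp_seq u, t <- supp_seq u].
exists N.+1 => s t us ut; rewrite ltnS; apply: (NE (s, t)).
by apply/allpairsP; exists (s, t); split=> //; exact: mem_supp_seq.
Qed.

(* D is twice the radius; 18 is three times the error 6 of [ca_four] and
   [ca_midpoint]. *)
Definition center u c (D : nat) : Prop :=
  (forall s, in_supp u s -> (2 * d (pos s) c <= D + 18)%N) /\
  (forall y, exists s, in_supp u s /\ (2 * d y c + D <= 2 * d (pos s) y + 18)%N).

(* The midpoint of a diametral pair. *)
Lemma center_exists u D : extent u D -> (exists s, in_supp u s) ->
  exists c D', [/\ center u c D', (D' < D)%N & extent u D'.+1].
Proof.
move=> uD [s0 us0].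
have [||[s t] /= [[us ut] stmax]] := @ex_max_bounded _
  (fun st => d (pos st.1) (pos st.2))
  (fun st => in_supp u st.1 /\ in_supp u st.2) D.
- by exists (s0, s0).
- by move=> [s t] /= [us ut]; exact/ltnW/uD.
have [c [sc tc]] := ca_midpoint (pos s) (pos t).
exists c, (d (pos s) (pos t)); split; first split.
(* As [s], [t] is a diametral pair, [ca_four] on [x], [c], [s], [t] puts [x] within about half the
   diameter of [c]; with [y] for [x] it shows that [s] or [t] is far from [y]. *)
- move=> x ux; have := stmax (x, s) (conj ux us); have := stmax (x, t) (conj ux ut).
  have := ca_distC (pos t) c; have := ca_distC (pos s) c.
  by case: (ca_four (pos x) c (pos s) (pos t)) => /=; have := ca_distC (pos s) c; lia.
- move=> y; have := ca_distC (pos t) c; have := ca_distC (pos s) c.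
  have := ca_distC (pos t) y; have := ca_distC (pos s) y.
  by case: (ca_four y c (pos s) (pos t)) => h *; [exists s | exists t]; split=> //; lia.
- exact: uD.
- by move=> x y ux uy; rewrite ltnS; exact: (stmax (x, y)).
Qed.

Lemma hit_near a u c D g s : center u c D -> hit a u g s ->
  (2 * d (pos s) (act g c) <= D + 18)%N.
Proof.
move=> [near _] [_ /near]; rewrite -(ca_act_isometry g) -pos_gshift gshiftVK.
by [].
Qed.

Lemma hit_far a u c D g y : center u c D -> ~~ (p %| gr_coef a g)%Z ->
  exists s, hit a u g s /\ (2 * d y (act g c) + D <= 2 * d (pos s) y + 18)%N.
Proof.
move=> [_ far] ag; have [s [us sy]] := far (act g^-1 y).
exists (gshift g s); split; first by split=> //; rewrite gshiftK.
rewrite -(ca_act_isometry g^-1) -[d (pos _) _](ca_act_isometry g^-1).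
by rewrite -pos_gshift gshiftK -ca_actM mulVg ca_act1.
Qed.

Local Notation dep := (d (ca_base X)).

Lemma translate_eq c g h : (d (act g c) (act h c) < 2000)%N -> g = h.
Proof.
move=> lt; apply: contrapT => gh; have hg1 : (h * g^-1)%g <> 1%g.
  by move=> E; apply: gh; apply: (@mulIg _ g^-1%g); rewrite mulgV.
by have := ca_displacement (act g c) hg1; rewrite -ca_actM mulgVK leqNgt lt.
Qed.

(** Seen from the base point, some support point of [g u] lies about [D / 2] beyond the center of
    [g u], and its depth is at most [T]. *)
Lemma center_depth u c D a T g : center u c D ->
  (forall g s, hit a u g s -> (dep (pos s) <= T)%N) ->
  ~~ (p %| gr_coef a g)%Z -> (2 * dep (act g c) + D <= 2 * T + 18)%N.
Proof.
move=> uc aT ag; have [t [tk]] := hit_far (ca_base X) uc ag.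
by have := aT _ _ tk; rewrite (ca_distC (pos t)); lia.
Qed.

(* Two translates of the same vector that meet near the maximal depth T have
   centers at bounded distance, so they coincide by the displacement bound. *)
Lemma hit_unique u c D a T : center u c D ->
  (forall g s, hit a u g s -> (dep (pos s) <= T)%N) ->
  forall g h s, hit a u g s -> hit a u h s -> (T <= dep (pos s) + 1000)%N -> h = g.
Proof.
move=> uc aT g h s ag ah sT; apply/esym; apply: (@translate_eq c).
have := hit_near uc ag; have := hit_near uc ah.
have := center_depth uc aT ag.1; have := center_depth uc aT ah.1.
have := ca_distC (act g c) (pos s); have := ca_distC (act h c) (pos s).
rewrite ?(ca_distC (ca_base X)) in sT *.
by case: (ca_four (act g c) (act h c) (pos s) (ca_base X)); lia.
Qed.

(** [ca_four] with [y] repeated is the triangle inequality up to 6, and [30 = 18 + 2 * 6]. *)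
Lemma center_depth_ge x y D L T : (2 * d x y <= D + 18)%N -> (T <= dep x + L)%N ->
  (2 * T <= 2 * dep y + D + 2 * L + 30)%N.
Proof.
have := ca_distxx y; have := ca_distC x (ca_base X); have := ca_distC y (ca_base X).
by case: (ca_four x (ca_base X) y y); have := ca_distC x y; lia.
Qed.

(** Coarsely, both centers lie on a geodesic from the base point to the deep point [x], at distances
    [A / 2] and [B / 2] from [x], hence [(B - A) / 2] apart. *)
Lemma centers_close x y1 y2 A B L T : (2 * d x y1 <= A + 18)%N ->
  (2 * d x y2 <= B + 18)%N -> (2 * dep y1 + A <= 2 * T + 18)%N ->
  (2 * dep y2 + B <= 2 * T + 18)%N -> (T <= dep x + L)%N -> (A <= B)%N ->
  (2 * d y1 y2 + A <= B + 2 * L + 48)%N.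
Proof.
have := ca_distC x (ca_base X); have := ca_distC y1 (ca_base X).
have := ca_distC y2 (ca_base X); have := ca_distC x y1.
by case: (ca_four y1 y2 x (ca_base X)); lia.
Qed.

(** * The deepest meeting point of two rows *)

Section Peak.
Variables (u1 u2 : 'rV[R]_m) (al be : R) (c1 c2 : ca_pt X) (D1 D2 : nat).
Hypothesis u1c : center u1 c1 D1.
Hypothesis u2c : center u2 c2 D2.
Hypothesis rel : forall s, (p %| rcoef (al *: u1 + be *: u2) s)%Z.

Lemma rel_hit1 s : ~~ (p %| rcoef (al *: u1) s)%Z -> exists h, hit be u2 h s.
Proof.
move=> nz; apply: coef_hit; apply: contra nz => b0.
by have := rel s; rewrite rcoefD rpredDr.
Qed.

Lemma rel_hit2 s : ~~ (p %| rcoef (be *: u2) s)%Z -> exists g, hit al u1 g s.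
Proof.
move=> nz; apply: coef_hit; apply: contra nz => b0.
by have := rel s; rewrite rcoefD rpredDl.
Qed.

(** Take the deepest point hit by either row. That row hits it only once by [hit_unique], so its
    coefficient survives there and the relation makes the other row hit it too. *)
Lemma peak : (exists g, ~~ (p %| gr_coef al g)%Z) \/ (exists h, ~~ (p %| gr_coef be h)%Z) ->
  exists t g0 h0, [/\ hit al u1 g0 t, hit be u2 h0 t,
    forall g s, hit al u1 g s -> (dep (pos s) <= dep (pos t))%N
  & forall h s, hit be u2 h s -> (dep (pos s) <= dep (pos t))%N].
Proof.
move=> nz; have [N1 N1P] := hit_bounded (fun s => dep (pos s)) al u1.
have [N2 N2P] := hit_bounded (fun s => dep (pos s)) be u2.
have [||t [[g tg] tmax]] := @ex_max_bounded _ (fun s => dep (pos s))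
  (fun s => exists g, hit al u1 g s \/ hit be u2 g s) (maxn N1 N2).
- case: nz => [[g ag]|[h bh]].
    by have [s [sg _]] := hit_far (ca_base X) u1c ag; exists s, g; left.
  by have [s [sh _]] := hit_far (ca_base X) u2c bh; exists s, h; right.
- by move=> s [g [/N1P|/N2P]]; rewrite leq_max => ->; rewrite ?orbT.
have max1 h s : hit al u1 h s -> (dep (pos s) <= dep (pos t))%N.
  by move=> hs; apply: tmax; exists h; left.
have max2 h s : hit be u2 h s -> (dep (pos s) <= dep (pos t))%N.
  by move=> hs; apply: tmax; exists h; right.
case: tg => tg.
- have /rel_hit1[h th] : ~~ (p %| rcoef (al *: u1) t)%Z.
    by apply: (coef_uniq_hit tg) => h th; apply: (hit_unique u1c max1 tg th); lia.
  by exists t, g, h.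
- have /rel_hit2[h th] : ~~ (p %| rcoef (be *: u2) t)%Z.
    by apply: (coef_uniq_hit tg) => h th; apply: (hit_unique u2c max2 tg th); lia.
  by exists t, h, g.
Qed.

(* If u2 is wider than u1 by a definite amount, then g u1 has room to lie well
   inside the ball around h0 u2; otherwise the centers of g u1 and g0 u1 are both
   near that of h0 u2, so g = g0, and g0 u1 meets h0 u2 at the very peak. *)
Lemma near_second g0 t g h0 z s : (D1 <= D2)%N ->
  (forall g s, hit al u1 g s -> (dep (pos s) <= dep (pos t))%N) ->
  (forall h s, hit be u2 h s -> (dep (pos s) <= dep (pos t))%N) ->
  hit al u1 g0 t -> hit be u2 h0 t -> hit al u1 g z -> hit be u2 h0 z ->
  (dep (pos t) <= dep (pos z) + 200)%N -> hit al u1 g s ->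
  ~ hit be u2 h0 s ->
  (2 * d (pos s) (act h0 c2) <= D2 + 100)%N /\ (dep (pos s) + 800 <= dep (pos t))%N.
Proof.
move=> D12 max1 max2 tg0 th0 zg zh0 zt sg nsh0.
have c1T k r : hit al u1 k r -> _ := fun kr => center_depth u1c max1 kr.1.
have c2T k r : hit be u2 k r -> _ := fun kr => center_depth u2c max2 kr.1.
have cgh := centers_close (hit_near u1c zg) (hit_near u2c zh0) (c1T _ _ zg) (c2T _ _ zh0) zt D12.
have deep : (dep (pos s) + 800 <= dep (pos t))%N.
  rewrite leqNgt; apply/negP => sdeep.
  (* Otherwise s is also hit by some h u2, whose center is close to that of h0 u2. *)
  have /rel_hit1[h sh] : ~~ (p %| rcoef (al *: u1) s)%Z.
    by apply: (coef_uniq_hit sg) => h sh; apply: (hit_unique u1c max1 sg sh); lia.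
  apply: nsh0; suff -> : h0 = h by [].
  apply: (@translate_eq c2).
  have sdeep' : (dep (pos t) <= dep (pos s) + 800)%N by lia.
  have cgh' := centers_close (hit_near u1c sg) (hit_near u2c sh) (c1T _ _ sg) (c2T _ _ sh) sdeep' D12.
  have := center_depth_ge (hit_near u1c zg) zt.
  have := c2T _ _ sh; have := c2T _ _ zh0; move: cgh cgh'.
  rewrite ![d (act g c1) _]ca_distC.
  by case: (ca_four (act h0 c2) (act h c2) (act g c1) (ca_base X));
    rewrite ?[d _ (ca_base X)]ca_distC ?[d (act g c1) _]ca_distC; lia.
split=> //.
have gl := center_depth_ge (hit_near u1c zg) zt.
have h0T := c2T _ _ zh0; have sc := hit_near u1c sg.
(* A gap of 400 between the widths absorbs the errors due to [z] lying up to 200 short of the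
   peak. *)
have [far|near] := leqP (D1 + 400) D2.
  by case: (ca_four (pos s) (act h0 c2) (act g c1) (ca_base X));
    rewrite ?[d _ (ca_base X)]ca_distC; lia.
(* At [t] the loss of depth is 0, so the estimate for [g0] stays within 100 even when the widths
   agree. *)
have tt0 : (dep (pos t) <= dep (pos t) + 0)%N by lia.
have cg0h := centers_close (hit_near u1c tg0) (hit_near u2c th0) (c1T _ _ tg0) (c2T _ _ th0) tt0 D12.
have gg0 : g = g0.
  apply: (@translate_eq c1); have := ca_distxx (act h0 c2).
  have := ca_distC (act g0 c1) (act h0 c2).
  by case: (ca_four (act g c1) (act g0 c1) (act h0 c2) (act h0 c2)); lia.
have gl0 := center_depth_ge (hit_near u1c tg0) tt0.
move: sc cgh gl; rewrite gg0 => sc cgh gl.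
by case: (ca_four (pos s) (act h0 c2) (act g0 c1) (ca_base X));
  rewrite ?[d _ (ca_base X)]ca_distC; lia.
Qed.

(** At points of [h0 u2] near the peak, the combination [u'] of [h0 u2] with the translates of [u1]
    meeting it there agrees with the whole relation, hence vanishes. So its support stays 200 short
    of the peak, in a slightly enlarged ball about the center of [h0 u2], and [ca_four] makes its
    diameter smaller than [D2]. *)
Lemma reduction_step : (D1 <= D2)%N ->
  (exists g, ~~ (p %| gr_coef al g)%Z) \/ (exists h, ~~ (p %| gr_coef be h)%Z) ->
  exists (b : int) (lam : R), ~~ (p %| b)%Z /\ extent (u2 *~ b + lam *: u1) D2.
Proof.
move=> D12 /peak[t [g0 [h0 [tg0 th0 max1 max2]]]].
pose b := gr_coef be h0.
pose Q g := `[< exists z, [/\ hit al u1 g z, hit be u2 h0 z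
                          & (dep (pos t) <= dep (pos z) + 200)%N] >].
pose lam0 := gr_mk (gr_supp al) (fun g => if Q g then gr_coef al g else 0).
have lam0E g : gr_coef lam0 g = if Q g then gr_coef al g else 0.
  by rewrite gr_mkE; case: ifPn => // /gr_outsupp ->; rewrite if_same.
pose u' := gr_term b h0 *: u2 + lam0 *: u1.
have supp2 s : in_supp u' s -> hit be u2 h0 s ->
    (2 * d (pos s) (act h0 c2) <= D2 + 100)%N /\ (dep (pos s) + 200 <= dep (pos t))%N.
  move=> u's sh; split; first by have := hit_near u2c sh; lia.
  rewrite leqNgt; apply/negP => deep; case/negP: u's.
  (* Terms of [al] outside [Q] cannot hit [s], and by [hit_unique] no translate of [u2] other than
     [h0 u2] does. *)
  have /= d1 : (p %| rcoef ((al - lam0) *: u1) s)%Z.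
    apply/negPn/negP => /coef_hit[g [+ su]].
    rewrite gr_coefD gr_coefN lam0E; case: ifPn => [_|/asboolPn nQ].
      by rewrite subrr dvdz0.
    rewrite subr0 => ag; case: nQ; exists s; split=> //; lia.
  have /= d2 : (p %| rcoef ((be - gr_term b h0) *: u2) s)%Z.
    apply/negPn/negP => /coef_hit[h [+ su]].
    rewrite gr_coefD gr_coefN gr_termE; case: eqP => [->|hh0].
      by rewrite subrr dvdz0.
    rewrite subr0 => bh; apply: hh0.
    have sh2 : hit be u2 h s by [].
    by apply: (hit_unique u2c max2 sh sh2); lia.
  have E : al *: u1 + be *: u2 =
      ((al - lam0) *: u1 + (be - gr_term b h0) *: u2) + u'.
    by rewrite !scalerBl /u' [X in _ = _ + X]addrC addrACA !subrK.
  have := rel s; rewrite E rcoefD [X in X + _]rcoefD rpredDl; last exact: rpredD.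
  by [].
have supp' s : in_supp u' s ->
    (2 * d (pos s) (act h0 c2) <= D2 + 100)%N /\ (dep (pos s) + 200 <= dep (pos t))%N.
  move=> u's; have [/(supp2 s u's)//|nsh] := pselect (hit be u2 h0 s).
  have d2 : (p %| rcoef (gr_term b h0 *: u2) s)%Z.
    apply/negPn/negP => /coef_hit[h [+ su]]; rewrite gr_termE.
    case: eqP => [hh0 bh|_]; last by rewrite dvdz0.
    by apply: nsh; split; [exact: bh | rewrite -hh0].
  move: u's; rewrite /in_supp rcoefD rpredDl // => /coef_hit[g [+ su]].
  rewrite lam0E; case: ifPn => [/asboolP[z [zg zh zt]] ag|_]; last by rewrite dvdz0.
  by have [] := near_second D12 max1 max2 tg0 th0 zg zh zt (conj ag su) nsh; split=> //; lia.
(* Translating by [h0^-1] turns the multiplier of [u2] into the integer [b]. *)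
have E : u2 *~ b + (gr_term 1 h0^-1%g * lam0) *: u1 = gr_term 1 h0^-1%g *: u'.
  rewrite /u' scalerDr !scalerA.
  have -> : gr_term 1 h0^-1%g * gr_term b h0 = gr_term b 1%g :> R.
    by rewrite [LHS]gr_mul_term mul1r mulVg.
  by rewrite gr_term_int scaler_int.
exists b, (gr_term 1 h0^-1%g * lam0); split; first exact: th0.1.
rewrite E => s1 s2; rewrite /in_supp !rcoef_term1 !invgK => /supp'[n1 p1] /supp'[n2 p2].
rewrite -(ca_act_isometry h0) -!pos_gshift.
have h0T := center_depth u2c max2 th0.1.
have hn := hit_near u2c th0.
have tt0 : (dep (pos t) <= dep (pos t) + 0)%N by lia.
have := center_depth_ge hn tt0.
by case: (ca_four (pos (gshift h0 s1)) (pos (gshift h0 s2)) (act h0 c2) (ca_base X));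
  rewrite ?[d _ (ca_base X)]ca_distC ?[d (act h0 c2) _]ca_distC; lia.
Qed.

End Peak.

(** Otherwise [peak], fed the relation [al u + 0 u], would give a hit by the zero element. *)
Lemma cancel_mod al u : (forall s, (p %| rcoef (al *: u) s)%Z) ->
  (exists s, in_supp u s) -> forall g, (p %| gr_coef al g)%Z.
Proof.
move=> rel us g; apply/negPn/negP => ag.
have [D uD] := extent_exists u; have [c [D' [uc _ _]]] := center_exists uD us.
have rel0 s : (p %| rcoef (al *: u + 0 *: u) s)%Z by rewrite scale0r addr0.
have [|t [g0 [h0 [_ [+ _] _ _]]]] := peak uc uc rel0; first by left; exists g.
by rewrite gr_coef0 dvdz0.
Qed.

(** * Splitting kernels modulo p *)

Definition vanish_mod k n (A : 'M[R]_(k, n)) : Prop :=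
  forall i j g, (p %| gr_coef (A i j) g)%Z.

Lemma vanish_mod0 k n : vanish_mod (0 : 'M_(k, n)).
Proof. by move=> i j g; rewrite mxE gr_coef0 dvdz0. Qed.

Lemma vanish_modD k n (A B : 'M_(k, n)) :
  vanish_mod A -> vanish_mod B -> vanish_mod (A + B).
Proof. by move=> hA hB i j g; rewrite mxE gr_coefD rpredD. Qed.

Lemma vanish_modMz k n (A : 'M_(k, n)) (c : int) : vanish_mod A -> vanish_mod (A *~ c).
Proof.
move=> hA i j g; have -> : (A *~ c) i j = A i j *~ c.
  by rewrite -scaler_int mxE mulrzl.
by rewrite gr_coefMz -mulrzr dvdz_mulr.
Qed.

Lemma vanish_mod_mulr k l n (A : 'M_(k, l)) (B : 'M_(l, n)) :
  vanish_mod A -> vanish_mod (A *m B).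
Proof.
move=> hA i j g; rewrite mxE gr_coef_sum; apply: rpred_sum => h _.
by rewrite gr_coefM; apply: rpred_sum => e _; exact: dvdz_mulr.
Qed.

Lemma vanish_mod_mull k l n (A : 'M_(k, l)) (B : 'M_(l, n)) :
  vanish_mod B -> vanish_mod (A *m B).
Proof.
move=> hB i j g; rewrite mxE gr_coef_sum; apply: rpred_sum => h _.
by rewrite gr_coefM; apply: rpred_sum => e _; exact: dvdz_mull.
Qed.

Lemma vanish_mod_rcoef u : vanish_mod u <-> forall s, (p %| rcoef u s)%Z.
Proof.
split=> [h s|h i j g]; first exact: h.
by rewrite (ord1 i); exact: (h (g, j)).
Qed.

Lemma vanish_mod_supp u : ~ (exists s, in_supp u s) -> vanish_mod u.
Proof.
move=> ns; apply/vanish_mod_rcoef => s; apply/negPn/negP => us.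
by apply: ns; exists s.
Qed.

Lemma mulmxMzl k l n (A : 'M[R]_(k, l)) (B : 'M[R]_(l, n)) (c : int) :
  (A *~ c) *m B = (A *m B) *~ c.
Proof. by rewrite -scaler_int -scalemxAl scaler_int. Qed.

Lemma mulmxMzr k l n (A : 'M[R]_(k, l)) (B : 'M[R]_(l, n)) (c : int) :
  A *m (B *~ c) = (A *m B) *~ c.
Proof. exact: (raddfMz (mulmx A)). Qed.

(* Modulo p, and up to the unit s, right multiplication by r is a retraction
   onto the left kernel of U. *)
Definition kernel_splits_mod k (U : 'M[R]_(k, m)) : Prop :=
  exists (r : 'M[R]_k) (s : int), [/\ ~~ (p %| s)%Z, vanish_mod (r *m U)
    & forall x : 'rV_k, vanish_mod (x *m U) -> vanish_mod (x *m r - x *~ s)].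

(** Modulo [p], [x *m B] kills [A *m U] when [x] kills [U], so [r] pulls back to [B *m r *m A] at
    the price of the factor [c]. *)
Lemma kernel_splits_mod_transport k (U : 'M[R]_(k, m)) (A B : 'M_k) (c : int) :
  ~~ (p %| c)%Z -> B *m A = 1%:M *~ c ->
  kernel_splits_mod (A *m U) -> kernel_splits_mod U.
Proof.
move=> pc BA [r [s [ps rU split]]]; exists (B *m r *m A), (c * s); split.
- by apply/negP => /p_prime/orP[]; exact/negP.
- by rewrite -!mulmxA; apply: vanish_mod_mull.
move=> x xU; have : vanish_mod (x *m B *m (A *m U)).
  by rewrite mulmxA -(mulmxA x) BA mulmxMzr mulmx1 mulmxMzl; exact: vanish_modMz.
move/split/(vanish_mod_mulr A); rewrite mulmxBl mulmxMzl -(mulmxA x B A) BA.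
by rewrite mulmxMzr mulmx1 !mulmxA mulrzA.
Qed.

Hypothesis p_neq1 : ~~ (p %| 1)%Z.

Lemma kernel_splits_mod_swap u1 u2 :
  kernel_splits_mod (col_mx u2 u1) -> kernel_splits_mod (col_mx u1 u2).
Proof.
pose A : 'M[R]_(1 + 1) := block_mx 0 1%:M 1%:M 0.
have -> : col_mx u2 u1 = A *m col_mx u1 u2.
  by rewrite mul_block_col !mul0mx !mul1mx add0r addr0.
apply: (@kernel_splits_mod_transport _ _ A A 1) => //.
by rewrite mulmx_block !mul0mx !mulmx0 !mulmx1 !addr0 !add0r -scalar_mx_block mulr1z.
Qed.

(** The Euclidean algorithm, by induction on the sum of the extents: a relation lets the narrower
    row reduce the wider one, until a row vanishes or no relation is left. *)
Lemma kernel_splits_mod_rows u1 u2 : kernel_splits_mod (col_mx u1 u2).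
Proof.
have [D1 e1] := extent_exists u1; have [D2 e2] := extent_exists u2.
have [N] := ubnP (D1 + D2); elim: N => // N IH in u1 u2 D1 D2 e1 e2 * => ltN.
(* If only [v1] vanishes, the kernel is the first coordinate by [cancel_mod]; if both rows vanish,
   it is everything. *)
have degenerate v1 v2 : ~ (exists s, in_supp v1 s) -> kernel_splits_mod (col_mx v1 v2).
  move=> /vanish_mod_supp v10; have [v2s|/vanish_mod_supp v20] := pselect (exists s, in_supp v2 s).
    exists (block_mx 1%:M 0 0 0), 1; split=> //.
      rewrite mul_block_col !mul0mx mul1mx !addr0 => i j g; rewrite mxE.
      by case: splitP => k _; [exact: v10 | rewrite mxE gr_coef0 dvdz0].
    move=> x; rewrite -[x]hsubmxK; set a := lsubmx x; set b := rsubmx x.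
    rewrite mul_row_col mul_row_block !mulmx0 mulmx1 !addr0 mulr1z => ab.
    have b0 : vanish_mod b.
      have /vanish_mod_rcoef bv : vanish_mod (b 0 0 *: v2).
        rewrite -mul_scalar_mx -mx11_scalar.
        have := vanish_modD ab (vanish_modMz (-1) (vanish_mod_mull a v10)).
        by rewrite mulrNz mulr1z addrC addKr.
      by move=> i j g; rewrite (ord1 i) (ord1 j); exact: cancel_mod bv v2s g.
    rewrite opp_row_mx add_row_mx subrr add0r => i j g; rewrite mxE.
    case: splitP => k _; first by rewrite mxE gr_coef0 dvdz0.
    by rewrite mxE gr_coefN rpredN; exact: b0.
  exists 1%:M, 1; split=> //; last by move=> x _; rewrite mulmx1 mulr1z subrr; exact: vanish_mod0.
  rewrite mul1mx => i j g; rewrite mxE; case: splitP => k _; [exact: v10|exact: v20].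
have [us1|] := pselect (exists s, in_supp u1 s); last exact: degenerate.
have [us2|ns2] := pselect (exists s, in_supp u2 s); last first.
  exact/kernel_splits_mod_swap/degenerate.
have [nrel|rel] := pselect (forall x : 'rV_(1 + 1),
    vanish_mod (x *m col_mx u1 u2) -> vanish_mod x).
  exists 0, 1; split=> //; first by rewrite mul0mx; exact: vanish_mod0.
  move=> x /nrel x0; rewrite mulmx0 sub0r mulr1z -mulrN1z; exact: vanish_modMz.
have reduce v1 v2 c1 c2 E1 E2 (a b : R) : center v1 c1 E1 -> center v2 c2 E2 ->
    extent v1 E1.+1 -> (E1.+1 + E2 < N)%N ->
    (forall s, (p %| rcoef (a *: v1 + b *: v2) s)%Z) ->
    (exists g, ~~ (p %| gr_coef a g)%Z) \/ (exists g, ~~ (p %| gr_coef b g)%Z) ->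
    (E1 <= E2)%N -> kernel_splits_mod (col_mx v1 v2).
  move=> v1c v2c e lt abv nz E12.
  have [s [l [ps e']]] := reduction_step v1c v2c abv E12 nz.
  (* [A] replaces [v2] by [s v2 + l v1], and [B] is its adjugate. *)
  pose A : 'M[R]_(1 + 1) := block_mx 1%:M 0 l%:M (1%:M *~ s).
  pose B : 'M[R]_(1 + 1) := block_mx (1%:M *~ s) 0 (- l%:M) 1%:M.
  apply: (@kernel_splits_mod_transport _ _ A B s) => //.
    rewrite mulmx_block !mul0mx !mulmx0 !mulmx1 !mul1mx !addr0 !add0r addNr.
    by rewrite -[1%:M *~ s]scaler_int scalemx1 -scalar_mx_block -scalemx1 scaler_int.
  rewrite mul_block_col !mul0mx !mul1mx addr0 mulmxMzl mul1mx mul_scalar_mx addrC.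
  exact: IH e e' lt.
(* When [E1 <= E2], the new rows have extents [E1.+1 <= D1] and [E2 < D2], so the sum drops; the
   other case is symmetric. *)
have [c1 [E1 [v1c lt1 e1']]] := center_exists e1 us1.
have [c2 [E2 [v2c lt2 e2']]] := center_exists e2 us2.
have [x [xU nx]] : exists x : 'rV_(1 + 1), vanish_mod (x *m col_mx u1 u2) /\ ~ vanish_mod x.
  by apply: contrapT => h; apply: rel => x xU; apply: contrapT => nx; apply: h; exists x.
pose a := lsubmx x 0 0; pose b := rsubmx x 0 0.
have xE : x *m col_mx u1 u2 = a *: u1 + b *: u2.
  by rewrite -[x in LHS]hsubmxK mul_row_col -!mul_scalar_mx /a /b -!mx11_scalar.
have nz : (exists g, ~~ (p %| gr_coef a g)%Z) \/ (exists g, ~~ (p %| gr_coef b g)%Z).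
  apply: contrapT => h; apply: nx => i j g; rewrite (ord1 i); apply/negPn/negP => nzx; apply: h.
  move: nzx; rewrite -[x]hsubmxK mxE; case: splitP => k _; rewrite (ord1 k) => nzx.
    by left; exists g.
  by right; exists g.
move: xU; rewrite xE => /vanish_mod_rcoef ab.
have [E12|/ltnW E21] := leqP E1 E2.
  by apply: (reduce u1 u2 c1 c2 E1 E2 a b) => //; lia.
apply: kernel_splits_mod_swap; apply: (reduce u2 u1 c2 c1 E2 E1 b a) => //.
- lia.
- by move=> s; rewrite addrC.
- by case: nz; [right|left].
Qed.

Lemma two_row_kernel_splits_mod (U : 'M[R]_(2, m)) : kernel_splits_mod U.
Proof. by rewrite -[U](@vsubmxK _ 1 1); exact: kernel_splits_mod_rows. Qed.

End Step.

(** * Splitting over the integers *)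

Section IntegralSplitting.
Variables (G : groupType).
Local Open Scope ring_scope.
Local Notation R := (group_ring G).

Lemma mx_torsion_free k n (A : 'M[R]_(k, n)) (c : int) : c != 0 -> A *~ c = 0 -> A = 0.
Proof.
move=> c0 Ac; apply/matrixP => i j; apply: grP => g; rewrite mxE gr_coef0.
have /(congr1 (fun B : 'M_(k, n) => gr_coef (B i j) g)) := Ac.
rewrite -scaler_int !mxE mulrzl gr_coefMz gr_coef0 -mulrzr => /eqP.
by rewrite mulf_eq0 intr_eq0 (negPf c0) orbF => /eqP.
Qed.

Lemma vanish_mod_div k n (A : 'M[R]_(k, n)) (p : int) :
  vanish_mod p A -> exists B, A = B *~ p.
Proof.
move=> Ap; exists (\matrix_(i, j) gr_mk (gr_supp (A i j))
  (fun g => (gr_coef (A i j) g %/ p)%Z)).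
apply/matrixP => i j; apply: grP => g.
rewrite -scaler_int !mxE mulrzl gr_coefMz gr_mkE; case: ifPn => [_|/gr_outsupp->].
  by rewrite -mulrzr intz divzK.
by rewrite mul0rz.
Qed.

Lemma kernel_splits_mod0 m k (U : 'M[R]_(k, m)) : kernel_splits_mod 0 U ->
  exists (r : 'M[R]_k) (s : int), [/\ s != 0, r *m U = 0
    & forall x : 'rV_k, x *m U = 0 -> x *m r = x *~ s].
Proof.
have v0 a b (A : 'M[R]_(a, b)) : vanish_mod 0 A <-> A = 0.
  split=> [h|->]; last exact: vanish_mod0.
  apply/matrixP => i j; apply: grP => g; rewrite mxE gr_coef0.
  by have := h i j g; rewrite dvd0z => /eqP.
move=> [r [s [ps /v0 rU split]]]; exists r, s; split=> //; first by rewrite dvd0z in ps.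
by move=> x /v0/split/v0/eqP; rewrite subr_eq0 => /eqP.
Qed.

Section Split.
Variables (k m l : nat) (U : 'M[R]_(k, m)) (V : 'M[R]_(m, l)).
Hypothesis UV : U *m V = 0.
Hypothesis exactUV : forall y : 'rV_m, y *m V = 0 -> exists x, y = x *m U.
Hypothesis splitU : forall p : int,
  (forall a b : int, (p %| (a * b)%R)%Z -> (p %| a)%Z || (p %| b)%Z) ->
  ~~ (p %| 1)%Z -> kernel_splits_mod p U.

(** A splitting modulo [M] that nevertheless kills [U] exactly, so that such splittings can be
    composed. *)
Definition kernel_lift (M : int) : Prop := exists r : 'M[R]_k, r *m U = 0 /\
  forall x : 'rV_k, x *m U = 0 -> exists y, x - x *m r = y *~ M.

Lemma exact_mx n (W : 'M[R]_(n, m)) : W *m V = 0 -> exists Z, W = Z *m U.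
Proof.
move=> WV; have /choice[z zE] (i : 'I_n) : exists z : 'rV_k, row i W = z *m U.
  by apply: exactUV; rewrite -row_mul WV row0.
exists (\matrix_i z i); apply/row_matrixP => i.
by rewrite row_mul rowK zE.
Qed.

Lemma kernel_lift1 : kernel_lift 1.
Proof. by exists 0; split=> [|x _]; [rewrite mul0mx|exists x; rewrite mulmx0 subr0]. Qed.

(** A splitting modulo [q] has [r *m U] divisible by [q]. As [V] kills the quotient too, exactness
    writes it as [Z *m U] after normalization, and subtracting [q Z] makes the product with [U]
    vanish exactly. *)
Lemma kernel_lift_prime q : prime q -> kernel_lift q%:Z.
Proof.
move=> q_pr; have [||r [s [qs /vanish_mod_div[W0 W0E] split]]] := splitU (p := q%:Z).
- by move=> a b; rewrite !dvdzE abszM Euclid_dvdM.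
- by rewrite dvdzE /= dvdn1 neq_ltn prime_gt1 ?orbT.
(* [v] inverts [s] modulo [q]. *)
have [u [v uv]] : exists u v, u * q%:Z + v * s = 1.
  have [u [v uv]] := Bezoutz q%:Z s; exists u, v; rewrite uv /gcdz /=.
  by congr Posz; apply/eqP; rewrite -[_ == _]/(coprime q _) prime_coprime.
have qn0 : q%:Z != 0 by rewrite eqz_nat -lt0n prime_gt0.
pose W := W0 *~ v.
have rW : (r *~ v) *m U = W *~ q%:Z by rewrite mulmxMzl W0E -!mulrzA mulrC.
have [Z ZE] : exists Z, W = Z *m U.
  apply: exact_mx; apply: (mx_torsion_free qn0).
  by rewrite -mulmxMzl -rW -mulmxA UV mulmx0.
exists (r *~ v - Z *~ q%:Z); split.
  by rewrite mulmxBl rW mulmxMzl -ZE subrr.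
move=> x xU; have [|y yE] := vanish_mod_div (split x _).
  by rewrite xU; exact: vanish_mod0.
exists (x *~ u - y *~ v + x *m Z).
rewrite mulmxBr !mulmxMzr.
have -> : x *m r = x *~ s + y *~ q%:Z by rewrite -yE addrC subrK.
rewrite -{1}[x]mulr1z -uv mulrzDr !mulrzDl !mulNrz -!mulrzA.
rewrite (mulrC q%:Z v) (mulrC v s) opprB opprD addrACA [x *~ (s * v) + _]addrA.
by rewrite subrr add0r addrAC.
Qed.

(** The complement of the new map is [(1 - r)(1 - r')]; the quotient of [x - x r] by a nonzero [M]
    is again in the kernel, so the second splitting applies to it. *)
Lemma kernel_liftM M N : kernel_lift M -> kernel_lift N -> kernel_lift (M * N).
Proof.
move=> [r [rU liftM]] [r' [rU' liftN]]; exists (r + r' - r *m r'); split.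
  by rewrite mulmxBl mulmxDl -mulmxA rU rU' mulmx0 addr0 subr0.
(* For [M = 0] the quotient [y] is arbitrary, but then [x = x *m r]. *)
have [M0|M0] := eqVneq M 0.
  rewrite M0 mul0r in liftM * => x xU; exists 0; have [y yE] := liftM x xU.
  move: yE; rewrite !mulr0z => /eqP; rewrite subr_eq0 => /eqP xr.
  by rewrite mulmxBr mulmxDr mulmxA -xr addrK subrr.
move=> x xU; have [y yE] := liftM x xU.
have yU : y *m U = 0.
  by apply: (mx_torsion_free M0); rewrite -mulmxMzl -yE mulmxBl xU -mulmxA rU mulmx0 subr0.
have [z zE] := liftN y yU; exists z.
rewrite mulrC mulrzA -zE mulrzBl -mulmxMzl -yE mulmxBl mulmxBr mulmxDr mulmxA.
by rewrite !opprB !opprD [x *m r *m r' + _]addrCA [LHS]addrA.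
Qed.

Lemma kernel_lift_nat n : (0 < n)%N -> kernel_lift n%:Z.
Proof.
have [N] := ubnP n; elim: N n => // N IH n; rewrite ltnS => nN n0.
have [->|n1] := eqVneq n 1%N; first exact: kernel_lift1.
have n_gt1 : (1 < n)%N by rewrite ltn_neqAle eq_sym n1.
rewrite -(divnK (pdiv_dvd n)) PoszM; apply: kernel_liftM.
  apply: IH; last by rewrite divn_gt0 ?pdiv_gt0 // dvdn_leq ?pdiv_dvd.
  by apply: leq_trans nN; rewrite ltn_Pdiv // prime_gt1 ?pdiv_prime.
exact/kernel_lift_prime/pdiv_prime.
Qed.

(** [tau] is [s] times a rational splitting and [r] a splitting modulo [s]. The rows of [tau] lie in
    the kernel, so [tau - tau r] is [s Y], and on the kernel [Y] is exactly the defect [1 - r]. *)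
Lemma kernel_retraction : exists r : 'M[R]_k, r *m U = 0 /\
  forall x : 'rV_k, x *m U = 0 -> x *m r = x.
Proof.
have [||tau [s [s0 tauU tauE]]] := kernel_splits_mod0 (splitU (p := 0) _ _).
- by move=> a b; rewrite !dvd0z mulf_eq0.
- by rewrite dvd0z.
have [r [rU lift]] : kernel_lift s.
  have [|r [rU lift]] := kernel_lift_nat (n := `|s|%N); first by rewrite absz_gt0.
  exists r; split=> // x /lift[y yE]; exists (y *~ sgz s).
  by rewrite yE abszEsg mulrzA.
have /choice[y yE] (i : 'I_k) : exists y : 'rV_k, row i tau - row i tau *m r = y *~ s.
  by apply: lift; rewrite -row_mul tauU row0.
pose Y := \matrix_i y i.
have YE : tau - tau *m r = Y *~ s.
  apply/row_matrixP => i; rewrite linearB /= row_mul yE.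
  by rewrite (raddfMz (row i)) /= rowK.
exists (r + Y); split.
  rewrite mulmxDl rU add0r; apply: (mx_torsion_free s0).
  by rewrite -mulmxMzl -YE mulmxBl tauU -mulmxA rU mulmx0 subr0.
move=> x xU; have xY : x *m Y = x - x *m r.
  apply/eqP; rewrite -subr_eq0; apply/eqP; apply: (mx_torsion_free s0).
  by rewrite mulrzBl -mulmxMzr -YE mulmxBr mulmxA tauE // mulmxMzl mulrzBl subrr.
by rewrite mulmxDr xY addrC subrK.
Qed.

End Split.
End IntegralSplitting.

(** * Fox calculus *)

Section LinearExtension.
Variables (G : groupType) (V : zmodType) (F : G -> V).
Local Open Scope fset_scope.
Local Open Scope ring_scope.
Implicit Types a b : group_ring G.

Definition lin_ext a : V := \sum_(g <- gr_supp a) F g *~ gr_coef a g.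

Lemma lin_extw (A : {fset G}) a : gr_supp a `<=` A ->
  lin_ext a = \sum_(g <- A) F g *~ gr_coef a g.
Proof.
by move=> sA; apply: big_fset_incl => // g _ /gr_outsupp ->; rewrite mulr0z.
Qed.

Lemma lin_extD a b : lin_ext (a + b) = lin_ext a + lin_ext b.
Proof.
rewrite (lin_extw (gr_suppD a b)) (lin_extw (fsubsetUl _ (gr_supp b))).
rewrite (lin_extw (fsubsetUr (gr_supp a) _)) -big_split /=.
by apply: eq_bigr => g _; rewrite gr_coefD mulrzDr.
Qed.

Lemma lin_ext_term c g : lin_ext (gr_term c g) = F g *~ c.
Proof. by rewrite (lin_extw (gr_supp_term c g)) big_seq_fset1 gr_termE eqxx. Qed.

Lemma lin_ext0 : lin_ext 0 = 0.
Proof. by rewrite /lin_ext gr_supp0 big_seq_fset0. Qed.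

Lemma lin_extB a b : lin_ext (a - b) = lin_ext a - lin_ext b.
Proof. by apply/eqP; rewrite -subr_eq opprK -lin_extD subrK. Qed.

Lemma lin_ext_sum (I : Type) (s : seq I) (a : I -> group_ring G) :
  lin_ext (\sum_(i <- s) a i) = \sum_(i <- s) lin_ext (a i).
Proof. exact: (big_morph lin_ext lin_extD lin_ext0). Qed.

End LinearExtension.

Section FoxCalculus.
Variables (G : groupType) (m : nat).
Variable phi : UMagmaMorphism.type (free_group 'I_m) G.
Local Open Scope ring_scope.
Local Notation R := (group_ring G).
Local Notation T := (gr_term 1 : G -> R).
Implicit Types (u v : free_group 'I_m) (w : seq (letter 'I_m)) (a : letter 'I_m) (i : 'I_m).

Lemma gr_term_mul (c e : int) g h : gr_term c g * gr_term e h = gr_term (c * e) (g * h)%g :> R.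
Proof. exact: gr_mul_term. Qed.

Lemma gr_termM g h : T (g * h)%g = T g * T h.
Proof. by rewrite gr_term_mul mul1r. Qed.

Lemma phi1 : phi 1%g = 1%g. Proof. exact: gmulf1. Qed.

Lemma phiM u v : phi (u * v)%g = (phi u * phi v)%g. Proof. exact: gmulfM. Qed.

Lemma phiV u : phi u^-1%g = (phi u)^-1%g. Proof. exact: gmulfV. Qed.

Definition fgen i : free_group 'I_m := fg_of [:: (i, false)].

Definition letter_val (a : letter 'I_m) : G :=
  if a.2 then (phi (fgen a.1))^-1%g else phi (fgen a.1).

Definition word_val (w : seq (letter 'I_m)) : G :=
  foldr (fun a g => (letter_val a * g)%g) 1%g w.

Lemma phi_fg_of (w : seq (letter 'I_m)) : phi (fg_of w) = word_val w.
Proof.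
elim: w => [|a w IH] /=; first by rewrite -[RHS]phi1; congr (phi _); exact: val_inj.
have -> : fg_of (a :: w) = (fg_of [:: a] * fg_of w)%g.
  apply: val_inj; rewrite -[RHS]/(reduce (reduce [:: a] ++ reduce w)).
  by rewrite reduce_catl reduce_catr.
rewrite phiM IH; congr (_ * _)%g; case: a => i [] //=; rewrite /letter_val /=.
rewrite -phiV; congr (phi _); exact: val_inj.
Qed.

Lemma letter_val_flip a : letter_val (flip a) = (letter_val a)^-1%g.
Proof. by case: a => i []; rewrite /letter_val /= ?invgK. Qed.

Definition fox_letter (a : letter 'I_m) : 'rV[R]_m :=
  if a.2 then - (T (letter_val a) *: delta_mx 0 a.1) else delta_mx 0 a.1.

Lemma fox_letter_flip a :
  fox_letter (flip a) + T (letter_val (flip a)) *: fox_letter a = 0.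
Proof.
case: a => i []; rewrite /fox_letter letter_val_flip /= /letter_val /=.
  by rewrite invgK scalerN scalerA -gr_termM mulgV scale1r subrr.
by rewrite addNr.
Qed.

(** The row of Fox derivatives pushed to [Z[G]]; the fold is the product rule
    [D(a w) = D a + a D w]. *)
Definition fox_word (w : seq (letter 'I_m)) : 'rV[R]_m :=
  foldr (fun a y => fox_letter a + T (letter_val a) *: y) 0 w.

Definition fox (u : free_group 'I_m) : 'rV[R]_m := fox_word u.

(** Cancelling a letter against its inverse preserves the derivatives, so the product rule holds in
    the free group. *)
Lemma fox_cons_red a w : fox_word (cons_red a w) = fox_word (a :: w).
Proof.
case: w => [|b w] /=; first by []. 
case: eqP => [->|_] /=; last by [].
rewrite scalerDr addrA scalerA -gr_termM.
have := fox_letter_flip (flip a); rewrite flipK => ->.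
by rewrite letter_val_flip mulgV scale1r add0r.
Qed.

Lemma fox_reduce w : fox_word (reduce w) = fox_word w.
Proof. by elim: w => //= a w IH; rewrite fox_cons_red /= IH. Qed.

Lemma fox_cat w1 w2 : fox_word (w1 ++ w2) = fox_word w1 + T (word_val w1) *: fox_word w2.
Proof.
elim: w1 => [|a w1 IH] /=; first by rewrite add0r scale1r.
by rewrite IH scalerDr addrA scalerA -gr_termM.
Qed.

Lemma phiE u : phi u = word_val u.
Proof. by rewrite -phi_fg_of; congr (phi _); apply: val_inj; rewrite /= reduce_id //; exact: valP. Qed.

Lemma foxM u v : fox (u * v)%g = fox u + T (phi u) *: fox v.
Proof. by rewrite /fox /= fox_reduce fox_cat phiE. Qed.

Lemma fox1 : fox 1%g = 0. Proof. by []. Qed.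

Lemma fox_fgen i : fox (fgen i) = delta_mx 0 i.
Proof. by rewrite /fox /= scaler0 addr0. Qed.

Lemma foxV u : fox u^-1%g = - (T (phi u)^-1%g *: fox u).
Proof. by apply/eqP; rewrite -addr_eq0 -phiV -foxM mulVg. Qed.

Definition fox_d1 : 'cV[R]_m := \col_i (T (phi (fgen i)) - 1).

(** The fundamental formula of Fox calculus, by telescoping along the word. *)
Lemma fox_d1E u : fox u *m fox_d1 = (T (phi u) - 1)%:M.
Proof.
rewrite phiE /fox; elim: (fg_val u) => [|a w IH] /=.
  by rewrite mul0mx subrr raddf0.
rewrite mulmxDl -scalemxAl IH scale_scalar_mx mulrBr mulr1 -gr_termM.
have -> : fox_letter a *m fox_d1 = (T (letter_val a) - 1)%:M.
  case: a => i []; rewrite /fox_letter /letter_val /= ?mulNmx -?scalemxAl -rowE;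
    apply/matrixP => j k; rewrite !ord1 !mxE eqxx mulr1n //.
  by rewrite mulrBr mulr1 -gr_termM mulVg opprB.
by rewrite -raddfD /= addrC addrA subrK.
Qed.

Section Presentation.
Variables (k : nat) (r : 'I_k -> free_group 'I_m).
Hypothesis phi_surj : forall g, exists u, phi u = g.
Hypothesis phi_ker : [set u | phi u = 1%g]%classic = normal_closure (range r).

Definition fox_d2 : 'M[R]_(k, m) := \matrix_j fox (r j).

Lemma fox_d2_d1 : fox_d2 *m fox_d1 = 0.
Proof.
apply/row_matrixP => j; rewrite row_mul rowK row0 fox_d1E.
have : [set u | phi u = 1%g]%classic (r j).
  by rewrite phi_ker => N _; apply; exists j.
by move=> /= ->; rewrite subrr raddf0.
Qed.

(** The elements of the kernel of [phi] whose Fox row lies in the image of [fox_d2] form a normal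
    subgroup containing the relators. *)
Lemma fox_ker u : phi u = 1%g -> exists z : 'rV_k, fox u = z *m fox_d2.
Proof.
move=> u1; have : [set u | phi u = 1%g]%classic u by [].
rewrite phi_ker => /(_ [set v | phi v = 1%g /\ exists z : 'rV_k, fox v = z *m fox_d2]%classic).
case; last by [].
- split=> /=.
  + by split; [exact: phi1 | exists 0; rewrite mul0mx fox1].
  + move=> x y [x1 [a xa]] [y1 [b yb]]; split; first by rewrite phiM x1 y1 mulg1.
    by exists (a + b); rewrite foxM x1 scale1r xa yb mulmxDl.
  + move=> x [x1 [a xa]]; split; first by rewrite phiV x1 invg1.
    by exists (- a); rewrite foxV x1 invg1 scale1r xa mulNmx.
  + move=> x y [x1 [a xa]]; split; first by rewrite conjgE !phiM phiV x1 mul1g mulVg.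
    exists (T (phi y)^-1%g *: a); rewrite conjgE !foxM x1 scale1r foxV phiV xa.
    by rewrite scalerDr addrCA addNr addr0 scalemxAl.
- move=> v [j _ <-]; split.
    have : [set u | phi u = 1%g]%classic (r j).
      by rewrite phi_ker => N _; apply; exists j.
    by [].
  by exists (delta_mx 0 j); rewrite -rowE rowK.
Qed.

Lemma fox_eq_mod u v : phi u = phi v -> exists z : 'rV_k, fox u = fox v + z *m fox_d2.
Proof.
move=> uv; have w1 : phi (u * v^-1)%g = 1%g by rewrite phiM phiV uv mulgV.
have [z zE] := fox_ker w1; exists z.
by have := foxM (u * v^-1)%g v; rewrite w1 mulgVK scale1r zE addrC.
Qed.

Definition lift_elt (g : G) : free_group 'I_m := sval (cid (phi_surj g)).

Lemma phi_lift_elt g : phi (lift_elt g) = g.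
Proof. by rewrite /lift_elt; case: cid. Qed.

(* The Z-linear map g |-> fox (lift_elt g) is a left inverse of fox_d1 modulo
   the image of fox_d2, and a right inverse of it on the augmentation ideal. *)
Definition fox_section : R -> 'rV[R]_m := lin_ext (fun g => fox (lift_elt g)).

Lemma fox_section_d1 (y : 'rV[R]_m) :
  exists z : 'rV_k, fox_section ((y *m fox_d1) 0 0) = y + z *m fox_d2.
Proof.
(* The chosen lift of [g x_i] and the chosen lift of [g] times [x_i] agree in [G], so [fox_eq_mod]
   compares their Fox rows. *)
have basic c g i : exists z : 'rV_k,
    fox_section (gr_term c g * (T (phi (fgen i)) - 1)) =
    gr_term c g *: delta_mx 0 i + z *m fox_d2.
  have cg h : gr_term c g * T h = gr_term c (g * h)%g.
    by rewrite gr_term_mul mulr1.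
  rewrite mulrBr mulr1 cg /fox_section lin_extB !lin_ext_term.
  have [|z ->] := @fox_eq_mod (lift_elt (g * phi (fgen i))%g) (lift_elt g * fgen i)%g.
    by rewrite phiM !phi_lift_elt.
  exists (z *~ c); rewrite foxM phi_lift_elt fox_fgen -(addrA (fox _)) mulrzDl.
  rewrite [LHS]addrAC subrr add0r mulrzDl mulmxMzl; congr (_ + _).
  by rewrite -scaler_int scalerA -gr_term_int gr_term_mul mulr1 mul1g.
have entry (a : R) i : exists z : 'rV_k,
    fox_section (a * (T (phi (fgen i)) - 1)) = a *: delta_mx 0 i + z *m fox_d2.
  rewrite {1 2}[a]gr_expand mulr_suml /fox_section lin_ext_sum scaler_suml -/fox_section.
  elim: (enum_fset (gr_supp a)) => [|g s [z IH]].
    by exists 0; rewrite !big_nil mul0mx addr0.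
  have [z' zE] := basic (gr_coef a g) g i; exists (z' + z).
  by rewrite !big_cons IH -/(fox_section _) zE mulmxDl addrACA.
have /choice[z zE] i := entry (y 0 i) i.
exists (\sum_i z i); rewrite mxE /fox_section lin_ext_sum mulmx_suml.
rewrite [in RHS](row_sum_delta y) -big_split /=; apply: eq_bigr => i _.
by rewrite mxE; exact: zE.
Qed.

Lemma fox_exact1 (y : 'rV[R]_m) : y *m fox_d1 = 0 -> exists z : 'rV_k, y = z *m fox_d2.
Proof.
move=> yd; have [z] := fox_section_d1 y.
rewrite yd mxE /fox_section lin_ext0 => /esym/eqP; rewrite addr_eq0 => /eqP ->.
by exists (- z); rewrite mulNmx.
Qed.

Lemma fox_exact0 (a : R) : augmentation a = 0 -> exists y : 'rV[R]_m, a%:M = y *m fox_d1.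
Proof.
move=> a0; exists (fox_section a).
(* Augmentation zero allows each [g] to be replaced by [g - 1], which [fox_d1E] reaches. *)
have aE : a = \sum_(g <- gr_supp a) (T g - 1) *~ gr_coef a g.
  have E1 : \sum_(g <- gr_supp a) (1 : R) *~ gr_coef a g = 0.
    by rewrite -[RHS](mulr0z (1 : R)) -a0 /augmentation mulrz_sumr.
  under eq_bigr do rewrite mulrzBl.
  rewrite sumrB [X in _ - X]E1 subr0 {1}[a]gr_expand; apply: eq_bigr => g _.
  apply: grP => h; rewrite gr_coefMz !gr_termE.
  by case: eqP => _; rewrite ?mul0rz // intz.
rewrite /fox_section /lin_ext mulmx_suml {1}aE raddf_sum; apply: eq_bigr => g _.
by rewrite mulmxMzl fox_d1E phi_lift_elt raddfMz.
Qed.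

End Presentation.

End FoxCalculus.

(** * The resolution *)

Section ProjectiveModules.
Local Open Scope ring_scope.
Variable R : nzRingType.

Section RowCombination.
Variables (n : nat) (M : lmodType R) (x : 'I_n -> M).

Definition row_comb (v : 'rV[R]_n) : M := \sum_i v 0 i *: x i.

Lemma row_comb_linear : linear row_comb.
Proof.
move=> a u v; rewrite /row_comb scaler_sumr -big_split /=.
by apply: eq_bigr => i _; rewrite !mxE scalerDl scalerA.
Qed.

HB.instance Definition _ := GRing.isLinear.Build R 'rV[R]_n M *:%R row_comb row_comb_linear.

End RowCombination.

Lemma projective_rV n : projective ('rV[R]_n : lmodType R).
Proof.
move=> M N p f p_surj; have [x xE] := choice (fun i : 'I_n => p_surj (f (delta_mx 0 i))).
exists (row_comb x : {linear _ -> _}) => v; rewrite [in RHS](row_sum_delta v) !linear_sum.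
by apply: eq_bigr => i _; rewrite !linearZ /= xE.
Qed.

Section FixedRows.
Variables (n : nat) (E : 'M[R]_n).

Definition fixed_rows : {pred 'rV[R]_n} := fun v => v *m E == v.

Lemma fixed_rows_closed : submod_closed fixed_rows.
Proof.
split=> [|a u v]; rewrite /fixed_rows !unfold_in ?mul0mx //.
by move=> /eqP uE /eqP vE; rewrite mulmxDl -scalemxAl uE vE.
Qed.

HB.instance Definition _ := GRing.isSubmodClosed.Build R 'rV[R]_n fixed_rows fixed_rows_closed.

(** For idempotent [E] this is its image, a direct summand of a free module. *)
Record fixmod := FixMod { fm_val :> 'rV[R]_n; _ : fm_val \in fixed_rows }.
HB.instance Definition _ := [isSub for fm_val].
HB.instance Definition _ := [Choice of fixmod by <:].
HB.instance Definition _ := [SubChoice_isSubLmodule of fixmod by <:].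

Lemma fixmodP (x : fixmod) : fm_val x *m E = fm_val x.
Proof. exact: eqP (valP x). Qed.

Hypothesis EE : E *m E = E.

Lemma fm_proj_subproof (v : 'rV[R]_n) : v *m E \in fixed_rows.
Proof. by rewrite unfold_in /fixed_rows -mulmxA EE. Qed.

Definition fm_proj (v : 'rV[R]_n) : fixmod := FixMod (fm_proj_subproof v).

Lemma fm_proj_linear : linear fm_proj.
Proof. by move=> a u v; apply: val_inj; rewrite /= mulmxDl -scalemxAl. Qed.

HB.instance Definition _ := GRing.isLinear.Build R 'rV[R]_n fixmod *:%R fm_proj fm_proj_linear.

(** Compose [f] with the projection from the free module, lift, and restrict to the summand. *)
Lemma projective_fixmod : projective (fixmod : lmodType R).
Proof.
move=> M N p f p_surj.
have [h hE] := projective_rV (f \o fm_proj : {linear _ -> _}) p_surj.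
exists (h \o (val : fixmod -> _) : {linear _ -> _}) => x /=; rewrite hE /=.
by congr (f _); apply: val_inj; exact: fixmodP.
Qed.

End FixedRows.
End ProjectiveModules.

Section Resolution.
Local Open Scope ring_scope.
Variables (G : groupType) (m k : nat).
Local Notation R := (group_ring G).
Variables (V : 'M[R]_(m, 1)) (U : 'M[R]_(k, m)) (E : 'M[R]_k).
Hypothesis EE : E *m E = E.
Hypothesis EU : E *m U = U.
Hypothesis kerU : forall x : 'rV_k, x *m U = 0 -> x *m E = 0.
Hypothesis UV : U *m V = 0.
Hypothesis exactUV : forall y : 'rV_m, y *m V = 0 -> exists x, y = x *m U.
Hypothesis augV : forall i, augmentation (V i 0) = 0.
Hypothesis exactV : forall a : R, augmentation a = 0 -> exists y : 'rV_m, a%:M = y *m V.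

(** [E] projects along the kernel of [U], so [U] is injective on [fixmod E] and has the same image
    there as on the free module; the resolution can stop in degree 2. *)
Definition res_modules (i : nat) : lmodType R :=
  match i with
  | 0 => 'rV[R]_1
  | 1 => 'rV[R]_m
  | 2 => fixmod E
  | _ => 'rV[R]_0
  end.

Definition res_maps (i : nat) : {linear res_modules i.+1 -> res_modules i} :=
  match i with
  | 0 => (mulmxr V : {linear 'rV[R]_m -> 'rV[R]_1})
  | 1 => (mulmxr U \o val : {linear fixmod E -> 'rV[R]_m})
  | 2 => (\0 : {linear 'rV[R]_0 -> fixmod E})
  | _ => (\0 : {linear 'rV[R]_0 -> 'rV[R]_0})
  end.

Definition row_augmentation (x : 'rV[R]_1) : trivial_module G := augmentation (x 0 0).

Lemma row_augmentation_linear : linear row_augmentation.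
Proof. by move=> a x y; rewrite /row_augmentation !mxE augmentationD augmentationM. Qed.

HB.instance Definition _ := GRing.isLinear.Build R 'rV[R]_1 (trivial_module G) *:%R
  row_augmentation row_augmentation_linear.

Lemma res_modules_proj i : projective (res_modules i).
Proof.
case: i => [|[|[|i]]]; [exact: projective_rV|exact: projective_rV| |exact: projective_rV].
exact: projective_fixmod.
Qed.

Lemma row_augmentation_surj y : exists x, row_augmentation x = y.
Proof. by exists (gr_term y 1%g)%:M; rewrite /row_augmentation mxE augmentation_term. Qed.

Lemma res_maps_exact0 x : row_augmentation x = 0 <-> exists y, res_maps 0 y = x.
Proof.
split=> [/exactV[y yE]|[y <-]].
  by exists y; rewrite [LHS]/= -yE -mx11_scalar.
rewrite /row_augmentation /= mxE augmentation_sum big1 // => i _.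
by rewrite augmentationM augV mulr0.
Qed.

Lemma res_maps_exactS i x : res_maps i x = 0 <-> exists y, res_maps i.+1 y = x.
Proof.
case: i x => [|[|[|i]]] x /=.
- split=> [/exactUV[y yE]|[y <-]]; last by rewrite -mulmxA UV mulmx0.
  by exists (fm_proj EE y); rewrite /= -mulmxA EU.
- split=> [xU|[y <-]]; last by rewrite mul0mx.
  by exists 0; apply: val_inj; rewrite /= -fixmodP kerU.
- by split=> _ //; exists 0; rewrite [x]thinmx0.
- by split=> _ //; exists 0; rewrite [x]thinmx0.
Qed.

Lemma cohomological_dimension_le2 : cohomological_dimension_le G 2.
Proof.
exists 2, (@ProjResolution R (trivial_module G) res_modules res_maps
  (row_augmentation : {linear 'rV[R]_1 -> trivial_module G}) res_modules_proj
  row_augmentation_surj res_maps_exact0 res_maps_exactS).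
by split=> // -[|[|[|i]]] //= _ x; exact: thinmx0.
Qed.

End Resolution.

(** * The coarse action of a hyperbolic isometry group *)

Section HyperbolicAction.
Local Open Scope ring_scope.
Variables (R : realType) (n : nat) (G : groupType) (a : isometric_action R n G).
Hypothesis disp : (2000%:R%:E <= infimum_displacement a)%E.

Lemma hyp_ndist_displacement g p : g <> 1%g -> (2000 <= hyp_ndist p (a g p))%N.
Proof.
move=> g1; have : (2000%:R%:E <= (hyp_dist p (a g p))%:E)%E.
  apply: le_trans disp _; apply: ereal_inf_lbound.
  by exists (p, g).
by rewrite lee_fin /hyp_ndist truncn_ge_nat // hyp_dist_ge0.
Qed.

Lemma hyp_ndist_isometry g p q : hyp_ndist (a g p) (a g q) = hyp_ndist p q.
Proof. by rewrite /hyp_ndist act_isometry. Qed.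

Definition hyp_coarse_action : coarse_action G :=
  CoarseAction (hyp_origin R n) (@hyp_ndistC R n) (@hyp_ndistxx R n)
    (@hyp_ndist_four R n) (@hyp_nmidpoint R n) (act1 a) (actM a)
    hyp_ndist_isometry hyp_ndist_displacement.

End HyperbolicAction.

Local Open Scope ring_scope.

Theorem corollary5 (R : realType) (n : nat) (G : groupType)
    (a : isometric_action R n G) :
  fg_relator_group 2 G ->
  (2000%:R%:E <= infimum_displacement a)%E ->
  cohomological_dimension_le G 2.
Proof.
move=> [m [r [phi [phi_surj phi_ker]]]] disp.
pose U := fox_d2 phi r; pose V := fox_d1 phi.
have UV : U *m V = 0 by exact: fox_d2_d1 phi_ker.
have exactUV (y : 'rV_m) : y *m V = 0 -> exists x, y = x *m U.
  exact: fox_exact1 phi_surj phi_ker y.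
have [rho [rhoU rhoE]] := kernel_retraction UV exactUV
  (fun p p_prime p1 => two_row_kernel_splits_mod (hyp_coarse_action disp) p_prime p1 U).
(* The rows of [rho] lie in the kernel of [U], which [rho] fixes; [1 - rho] is then the projection
   along that kernel. *)
have rho2 : rho *m rho = rho.
  apply/row_matrixP => i; rewrite row_mul rhoE //.
  by rewrite -row_mul rhoU row0.
apply: (@cohomological_dimension_le2 _ _ _ V U (1%:M - rho)) => //.
- by rewrite mulmxBl mul1mx mulmxBr mulmx1 rho2 subrr subr0.
- by rewrite mulmxBl rhoU mul1mx subr0.
- by move=> x xU; rewrite mulmxBr mulmx1 rhoE // subrr.
- move=> i; rewrite mxE; apply: (addIr (augmentation (1 : group_ring G))).
  by rewrite -augmentationD subrK augmentation_term augmentation1.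
- exact: fox_exact0 phi_surj.
Qed.
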